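(* The entanglement measures $\mathcal{T}_{min}$ and $\mathcal{T}_{GM}$ on three-qubit states are genuine multipartite entanglement (GME) measures. That is, for each $E\in\{\mathcal{T}_{min},\mathcal{T}_{GM}\}$: (i) for every three-qubit state $\rho$, $E(\rho)>0$ if and only if $\rho$ is not biseparable; (ii) $E$ is invariant under local unitary transformations; (iii) $E$ is not increasing on average under LOCC, i.e. if an LOCC transformation applied to $\rho$ yields states $\{\rho_k\}$ with probabilities $\{p_k\}$, then $\sum_k p_kE(\rho_k)\le E(\rho)$; (iv) $E$ is convex.
   Context: Setting: three qubits $A,B,C$, with Hilbert space $\mathbb{C}^2\otimes\mathbb{C}^2\otimes\mathbb{C}^2$; states are density operators, pure states are unit vectors. Fully entangled fraction: for a two-qubit state $\rho$, $f(\rho)=\max_{|e\rangle}\langle e|\rho|e\rangle$, the maximum being over all maximally entangled unit vectors $|e\rangle\in\mathbb{C}^2\otimes\mathbb{C}^2$ (both reduced states equal to $I/2$). Maximal average teleportation fidelity: for distinct $i,j,k\in\{A,B,C\}$, $$F_{ij}(\rho_{ABC})=\frac{2f_{ij}(\rho_{ABC})+1}{3},\qquad f_{ij}(\rho_{ABC})=\max_{U_k}\sum_{t=0}^{1}\langle t|U_k\rho_kU_k^\dagger|t\rangle\, f\!\left(\rho_{ij}^{U_k,t}\right),$$ where $U_k$ ranges over $2\times2$ unitaries on system $k$, $\rho_k$ is the reduced state of $k$, and $\rho_{ij}^{U_k,t}$ is the normalized state of systems $i,j$ after measuring $k$ in the orthonormal basis $\{U_k^\dagger|0\rangle,U_k^\dagger|1\rangle\}$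 and obtaining outcome $t$ (zero-probability terms count as $0$). $F_{ij}=F_{ji}$. Known formula (from earlier literature) for pure states: $F_{ij}(|\phi\rangle_{ABC})=\frac{1}{3}\left(\sqrt{\tau+C_{ij}^2}+2\right)$, where $C_{ij}$ is the (Wootters) concurrence of the two-qubit reduced state $\rho_{ij}$ of $|\phi\rangle$, $C_{i(jk)}=\sqrt{2(1-\mathrm{Tr}\,\rho_i^2)}$, and $\tau=C_{i(jk)}^2-C_{ij}^2-C_{ik}^2$ is the three-tangle (independent of the choice of $i$). Measures: for a three-qubit pure state let $\mathcal{T}_{ij}=3F_{ij}-2$, and define on pure states $$\mathcal{T}_{min}=\min\{\mathcal{T}_{AB},\mathcal{T}_{BC},\mathcal{T}_{CA}\},\qquad \mathcal{T}_{GM}=\sqrt[3]{\mathcal{T}_{AB}\mathcal{T}_{BC}\mathcal{T}_{CA}}.$$ On mixed states both are defined by the convex roof $E(\rho)=\min\sum_l p_lE(|\psi_l\rangle)$, the minimum being over all decompositions $\rho=\sum_l p_l|\psi_l\rangle\langle\psi_l|$ into pure states. Biseparable: a pure state is biseparable if it is a product vector with respect to some bipartition of the set of parties into two nonempty subsets; a mixed state is biseparable if it is a convex combination of biseparable pure states (possibly with respect to different bipartitions). LOCC: a finite sequence of rounds; in each round one party, chosen depending on earlier outcomes, performs on its qubit a measurement given by $2\times2$ operators $\{M_t\}$ with $\sum_tM_t^\dagger M_t=I$ (also chosen depending on earlier outcomes) and announces the outcome; the state is updated to $M_t\rho M_t^\dagger/\mathrm{Tr}(M_t\rho M_t^\dagger)$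 with probability $\mathrm{Tr}(M_t\rho M_t^\dagger)$. Part of the classical record may be discarded, so that the corresponding states are averaged. *)

(* Defs.v *)
From HB Require Import structures.
From mathcomp Require Import all_boot all_order all_algebra.
From mathcomp Require Import complex mxtens.
From mathcomp Require Import classical_sets reals exp.

Set Implicit Arguments.
Unset Strict Implicit.
Unset Printing Implicit Defensive.

Import Order.TTheory GRing.Theory Num.Theory.
Local Open Scope ring_scope.
Local Open Scope complex_scope.
Local Open Scope sesquilinear_scope.

Definition partyA : 'I_3 := @Ordinal 3 0 isT.
Definition partyB : 'I_3 := @Ordinal 3 1 isT.
Definition partyC : 'I_3 := @Ordinal 3 2 isT.

(* The computational basis vector |b_A b_B b_C>, numbered in agreement with the
   Kronecker product [*t]. *)
Definition ket_index (b : 'I_3 -> 'I_2) : 'I_(2 * 2 * 2) :=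
  mxtens_index (mxtens_index (b partyA, b partyB), b partyC).

(* For [i != j]: the basis vector in which parties [i] and [j] carry the two
   bits of [r] and the third party carries the bit [t]. *)
Definition split_index (i j : 'I_3) (r : 'I_(2 * 2)) (t : 'I_2)
    : 'I_(2 * 2 * 2) :=
  ket_index (fun l => if l == i then (mxtens_unindex r).1
                      else if l == j then (mxtens_unindex r).2 else t).

Section States.
Variable R : realType.
Implicit Types (n : nat) (i j k : 'I_3).

Definition adj m n (A : 'M[R[i]]_(m, n)) : 'M[R[i]]_(n, m) := A ^t*.

Definition projector n (psi : 'cV[R[i]]_n) : 'M[R[i]]_n := psi *m adj psi.

Definition unit_vector n (psi : 'cV[R[i]]_n) : Prop :=
  (adj psi *m psi) ord0 ord0 = 1.

(* <v|A|v>; it is real when [A] is Hermitian. *)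
Definition expval n (A : 'M[R[i]]_n) (v : 'cV[R[i]]_n) : R :=
  complex.Re ((adj v *m A *m v) ord0 ord0).

(* In [R[i]], [0 <= z] means that [z] is real and nonnegative. *)
Definition density n (rho : 'M[R[i]]_n) : Prop :=
  [/\ adj rho = rho,
      forall v : 'cV[R[i]]_n, 0 <= (adj v *m rho *m v) ord0 ord0
    & \tr rho = 1].

Definition local_op (M : 'I_3 -> 'M[R[i]]_2) : 'M[R[i]]_(2 * 2 * 2) :=
  M partyA *t M partyB *t M partyC.

Definition at_party k (M : 'M[R[i]]_2) : 'M[R[i]]_(2 * 2 * 2) :=
  local_op (fun l => if l == k then M else 1%:M).

(* The partial trace over the party other than [i] and [j]. *)
Definition reduce_pair i j (rho : 'M[R[i]]_(2 * 2 * 2)) : 'M[R[i]]_(2 * 2) :=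
  \matrix_(r, s) \sum_t rho (split_index i j r t) (split_index i j s t).

(* The partial trace over [i] and [j]. *)
Definition reduce_third i j (rho : 'M[R[i]]_(2 * 2 * 2)) : 'M[R[i]]_2 :=
  \matrix_(s, t) \sum_r rho (split_index i j r s) (split_index i j r t).

Definition reduce_fst (rho : 'M[R[i]]_(2 * 2)) : 'M[R[i]]_2 :=
  \matrix_(a, b) \sum_t rho (mxtens_index (a, t)) (mxtens_index (b, t)).

Definition reduce_snd (rho : 'M[R[i]]_(2 * 2)) : 'M[R[i]]_2 :=
  \matrix_(a, b) \sum_t rho (mxtens_index (t, a)) (mxtens_index (t, b)).

Definition max_entangled (e : 'cV[R[i]]_(2 * 2)) : Prop :=
  [/\ unit_vector e, reduce_fst (projector e) = (2%:R^-1)%:M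
    & reduce_snd (projector e) = (2%:R^-1)%:M].

(* Here and below, maxima and minima over sets of reals are rendered by [sup]
   and [inf]; on states they are attained, by compactness. *)
Definition entangled_fraction (rho : 'M[R[i]]_(2 * 2)) : R :=
  sup [set x | exists2 e, max_entangled e & x = expval rho e]%classic.

(* <t| U rho_k U^dagger |t>, where [k] is the party other than [i] and [j]. *)
Definition outcome_prob i j (rho : 'M[R[i]]_(2 * 2 * 2))
    (U : 'M[R[i]]_2) (t : 'I_2) : R :=
  complex.Re ((U *m reduce_third i j rho *m adj U) t t).

(* Party [k] projects onto the ray of U^dagger |t>.  An outcome of probability
   zero yields the zero matrix, since [0^-1 = 0]. *)
Definition outcome_state i j k (rho : 'M[R[i]]_(2 * 2 * 2))
    (U : 'M[R[i]]_2) (t : 'I_2) : 'M[R[i]]_(2 * 2) :=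
  let P := at_party k (projector (col t (adj U))) in
  ((outcome_prob i j rho U t)^-1)%:C *: reduce_pair i j (P *m rho *m adj P).

(* In the next three definitions [i], [j], [k] are meant to be the three
   parties in some order; [k] performs the measurement. *)
Definition assisted_fraction i j k (rho : 'M[R[i]]_(2 * 2 * 2)) : R :=
  sup [set x | exists2 U : 'M[R[i]]_2, U \is unitarymx &
         x = \sum_t outcome_prob i j rho U t *
               entangled_fraction (outcome_state i j k rho U t)]%classic.

Definition teleport_fidelity i j k (rho : 'M[R[i]]_(2 * 2 * 2)) : R :=
  (2 * assisted_fraction i j k rho + 1) / 3.

Definition tele i j k (psi : 'cV[R[i]]_(2 * 2 * 2)) : R :=
  3 * teleport_fidelity i j k (projector psi) - 2.

Definition Tmin_pure (psi : 'cV[R[i]]_(2 * 2 * 2)) : R :=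
  Num.min (tele partyA partyB partyC psi)
    (Num.min (tele partyB partyC partyA psi) (tele partyC partyA partyB psi)).

Definition TGM_pure (psi : 'cV[R[i]]_(2 * 2 * 2)) : R :=
  (tele partyA partyB partyC psi * tele partyB partyC partyA psi *
   tele partyC partyA partyB psi) `^ (3^-1).

Definition pure_decomposition m n (rho : 'M[R[i]]_n) (p : 'I_m -> R)
    (psi : 'I_m -> 'cV[R[i]]_n) : Prop :=
  [/\ forall l, 0 <= p l, \sum_l p l = 1, forall l, unit_vector (psi l)
    & rho = \sum_l (p l)%:C *: projector (psi l)].

Definition convex_roof n (E : 'cV[R[i]]_n -> R) (rho : 'M[R[i]]_n) : R :=
  inf [set x | exists m (p : 'I_m -> R) (psi : 'I_m -> 'cV[R[i]]_n),
         pure_decomposition rho p psi /\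
         x = \sum_l p l * E (psi l)]%classic.

Definition Tmin : 'M[R[i]]_(2 * 2 * 2) -> R := convex_roof Tmin_pure.

Definition TGM : 'M[R[i]]_(2 * 2 * 2) -> R := convex_roof TGM_pure.

Definition restrict_bits (S : {set 'I_3}) (b : {ffun 'I_3 -> 'I_2})
    : {ffun {l : 'I_3 | l \in S} -> 'I_2} := [ffun l => b (val l)].

(* The amplitudes factor across [S | ~: S]; [f] and [g] are the components of
   the two factors, which live on the qubits of [S] and of [~: S]. *)
Definition product_across (S : {set 'I_3}) (psi : 'cV[R[i]]_(2 * 2 * 2))
    : Prop :=
  exists (f : {ffun {l : 'I_3 | l \in S} -> 'I_2} -> R[i])
         (g : {ffun {l : 'I_3 | l \in ~: S} -> 'I_2} -> R[i]),
    forall b : {ffun 'I_3 -> 'I_2},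
      psi (ket_index b) ord0 =
        f (restrict_bits S b) * g (restrict_bits (~: S) b).

Definition biseparable_pure (psi : 'cV[R[i]]_(2 * 2 * 2)) : Prop :=
  exists S : {set 'I_3}, [/\ S != finset.set0, ~: S != finset.set0
    & product_across S psi].

Definition biseparable (rho : 'M[R[i]]_(2 * 2 * 2)) : Prop :=
  exists m (p : 'I_m -> R) (psi : 'I_m -> 'cV[R[i]]_(2 * 2 * 2)),
    pure_decomposition rho p psi /\ forall l, biseparable_pure (psi l).

(* A protocol is a finite tree.  At [Round k M next], party [k] measures with
   the operators [M t] and announces [t], and the protocol goes on as [next t].
   The leaves carry the part of the record that is kept in the end: branches
   with the same label are averaged. *)
Inductive locc (m : nat) : Type :=
| Stop of 'I_m
| Round (k : 'I_3) (n : nat) (M : 'I_n -> 'M[R[i]]_2) (next : 'I_n -> locc m).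

Fixpoint locc_valid m (P : locc m) : Prop :=
  match P with
  | Stop _ => True
  | Round _ n M next =>
      \sum_t adj (M t) *m M t = 1%:M /\ forall t, locc_valid (next t)
  end.

Definition meas_prob k (M : 'M[R[i]]_2) (rho : 'M[R[i]]_(2 * 2 * 2)) : R :=
  complex.Re (\tr (at_party k M *m rho *m adj (at_party k M))).

Definition meas_state k (M : 'M[R[i]]_2) (rho : 'M[R[i]]_(2 * 2 * 2))
    : 'M[R[i]]_(2 * 2 * 2) :=
  ((meas_prob k M rho)^-1)%:C *:
    (at_party k M *m rho *m adj (at_party k M)).

Fixpoint locc_prob m (P : locc m) (rho : 'M[R[i]]_(2 * 2 * 2)) (l : 'I_m) : R :=
  match P with
  | Stop l' => (l' == l)%:R
  | Round k _ M next =>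
      \sum_t meas_prob k (M t) rho *
             locc_prob (next t) (meas_state k (M t) rho) l
  end.

(* The sum, over the branches labelled [l], of probability times final state. *)
Fixpoint locc_weighted m (P : locc m) (rho : 'M[R[i]]_(2 * 2 * 2)) (l : 'I_m)
    : 'M[R[i]]_(2 * 2 * 2) :=
  match P with
  | Stop l' => (l' == l)%:R *: rho
  | Round k _ M next =>
      \sum_t (meas_prob k (M t) rho)%:C *:
             locc_weighted (next t) (meas_state k (M t) rho) l
  end.

Definition locc_state m (P : locc m) (rho : 'M[R[i]]_(2 * 2 * 2)) (l : 'I_m)
    : 'M[R[i]]_(2 * 2 * 2) :=
  ((locc_prob P rho l)^-1)%:C *: locc_weighted P rho l.

Definition detects_gme (E : 'M[R[i]]_(2 * 2 * 2) -> R) : Prop :=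
  forall rho, density rho -> (0 < E rho <-> ~ biseparable rho).

Definition local_unitary_invariant (E : 'M[R[i]]_(2 * 2 * 2) -> R) : Prop :=
  forall rho (U : 'I_3 -> 'M[R[i]]_2), density rho ->
    (forall k, U k \is unitarymx) ->
    E (local_op U *m rho *m adj (local_op U)) = E rho.

Definition locc_monotone (E : 'M[R[i]]_(2 * 2 * 2) -> R) : Prop :=
  forall rho m (P : locc m), density rho -> locc_valid P ->
    \sum_l locc_prob P rho l * E (locc_state P rho l) <= E rho.

Definition convex_on_states (E : 'M[R[i]]_(2 * 2 * 2) -> R) : Prop :=
  forall rho sigma (x : R), density rho -> density sigma -> 0 <= x <= 1 ->
    E (x%:C *: rho + (1 - x)%:C *: sigma) <= x * E rho + (1 - x) * E sigma.

Definition gme_measure (E : 'M[R[i]]_(2 * 2 * 2) -> R) : Prop :=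
  [/\ detects_gme E, local_unitary_invariant E, locc_monotone E
    & convex_on_states E].

End States.

(* Main.v *)
Require Import Defs.
From HB Require Import structures.
From mathcomp Require Import all_boot all_order all_algebra.
From mathcomp Require Import complex mxtens ring lra.
From mathcomp Require Import boolp classical_sets reals exp topology normedtype.
From mathcomp Require Import derive realfun.

(* Measuring party k of a pure state leads, once the fully entangled fraction
   of each outcome is evaluated, to 3 F_ij - 2 = 2 max_U sum_t |(U Q U^T)_tt|,
   where Q is the symmetric 2x2 matrix obtained by polarising the determinant
   on the two slices (indexed by the bit of k) of the amplitude tensor.  By
   Takagi's factorisation the maximum is the trace norm of Q.  A local operator
   M multiplies Q by det M (at i or j) or replaces it by M Q M^T (at k), which
   makes each of the three quantities nonincreasing on average under a local
   measurement; minimum and geometric mean inherit this (the latter by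
   Hoelder).  Q vanishes exactly when the two slices share a range or a kernel,
   i.e. when i or j splits off.  Convex roofs of such functions are LOCC
   monotones, and a vanishing roof is attained because conic Caratheodory bounds
   the length of the ensembles, which makes the space of decompositions
   compact. *)

Set Implicit Arguments.
Unset Strict Implicit.
Unset Printing Implicit Defensive.

Import Order.TTheory GRing.Theory Num.Theory.
Import numFieldNormedType.Exports.
Local Open Scope ring_scope.
Local Open Scope complex_scope.
Local Open Scope sesquilinear_scope.

(** * Complex 2x2 matrices and their trace norm *)

(** For an outcome with unnormalised amplitude matrix A, probability times fully entangled fraction
    is half the square of the trace norm of A, that is fro A / 2 + |det A|. The first terms add up
    to 1/2 in every basis, so only the determinants compete, and these are the diagonal entries of U
    Q U^T. To pass from pure states to ensembles, the measures are extended to functions on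
    unnormalised vectors that are homogeneous of degree two. Weights, normalisations and branches of
    probability 0 are then absorbed into the vectors, and a protocol acts on them by plain
    multiplication. Invariance, monotonicity and convexity follow from near-optimal ensembles.
    Detection does not: a vanishing infimum has to yield an actual biseparable decomposition, so the
    length of near-optimal ensembles must be bounded independently of the error. *)

Lemma sum2 (V : nmodType) (F : 'I_2 -> V) : \sum_i F i = F 0 + F 1.
Proof.
by rewrite !big_ord_recl big_ord0 addr0; congr (_ + F _); apply/val_inj.
Qed.

Lemma ord2P (P : 'I_2 -> Prop) : P 0 -> P 1 -> forall i, P i.
Proof.
by move=> P0 P1 [[|[|//]] Hi]; [move: P0|move: P1]; congr P; apply/val_inj.
Qed.

Lemma det2 (K : comNzRingType) (A : 'M[K]_2) :
  \det A = A 0 0 * A 1 1 - A 0 1 * A 1 0.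
Proof.
have h01 : lift 0 0 = 1 :> 'I_2 by apply/val_inj.
have h10 : lift 1 0 = 0 :> 'I_2 by apply/val_inj.
have e (B : 'M[K]_2) i j : \det (row' i (col' j B)) = B (lift i 0) (lift j 0).
  by rewrite [LHS]det_mx11 !mxE.
rewrite (expand_det_row _ 0) sum2 /cofactor !e h01 h10.
by rewrite expr0 expr1 mul1r mulN1r mulrN.
Qed.

(* The norm of [R[i]] is valued in [R[i]]; [cabs] is its real-valued version.
   Both are locked because [rmorphD] would see through the sum of squares. *)
HB.lock Definition sq (R : realType) (z : R[i]) : R :=
  complex.Re z ^+ 2 + complex.Im z ^+ 2.
HB.lock Definition cabs (R : realType) (z : R[i]) : R := Num.sqrt (sq z).

Section ComplexMatrices.
Variable R : realType.
Local Notation C := R[i].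
Local Notation conj := (@Num.conj C).
Implicit Types z w : C.

Lemma sq_ge0 z : 0 <= sq z.
Proof. by rewrite sq.unlock addr_ge0 ?sqr_ge0. Qed.
Lemma cabs_ge0 z : 0 <= cabs z.
Proof. by rewrite cabs.unlock sqrtr_ge0. Qed.
Lemma cabsE z : (cabs z)%:C = `|z|.
Proof. by rewrite normc_def cabs.unlock sq.unlock. Qed.
Lemma cabs2 z : cabs z ^+ 2 = sq z.
Proof. by rewrite cabs.unlock sqr_sqrtr ?sq_ge0. Qed.
Lemma sqE z : (sq z)%:C = z * conj z.
Proof. by rewrite -normCK sq.unlock add_Re2_Im2. Qed.
Lemma cabsM z w : cabs (z * w) = cabs z * cabs w.
Proof. by apply: complexI; rewrite cabsE rmorphM /= !cabsE normrM. Qed.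
Lemma cabs_conj z : cabs (conj z) = cabs z.
Proof. by apply: complexI; rewrite !cabsE norm_conjC. Qed.
Lemma sq_conj z : sq (conj z) = sq z.
Proof. by rewrite -!cabs2 cabs_conj. Qed.
Lemma cabsD z w : cabs (z + w) <= cabs z + cabs w.
Proof. by rewrite -lecR rmorphD /= !cabsE ler_normD. Qed.
Lemma cabsN z : cabs (- z) = cabs z.
Proof. by apply: complexI; rewrite !cabsE normrN. Qed.
Lemma cabsB z w : cabs (z - w) <= cabs z + cabs w.
Proof. by rewrite (le_trans (cabsD _ _)) ?cabsN. Qed.
Lemma cabs_real (x : R) : 0 <= x -> cabs x%:C = x.
Proof. by move=> x0; apply: complexI; rewrite cabsE ger0_norm // ler0c. Qed.
Lemma cabs0 : cabs (0 : C) = 0. Proof. by rewrite (cabs_real (lexx 0)). Qed.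
Lemma cabs1 : cabs (1 : C) = 1. Proof. by rewrite (cabs_real ler01). Qed.
Lemma cabs_eq0 z : (cabs z == 0) = (z == 0).
Proof. by rewrite -(inj_eq (@complexI R)) cabsE normr_eq0. Qed.
Lemma sqM z w : sq (z * w) = sq z * sq w.
Proof. by rewrite -!cabs2 cabsM exprMn. Qed.
Lemma sq0 : sq (0 : C) = 0. Proof. by rewrite -cabs2 cabs0 expr0n. Qed.
Lemma sq_eq0 z : (sq z == 0) = (z == 0).
Proof. by rewrite -cabs2 sqrf_eq0 cabs_eq0. Qed.

Definition fro m n (A : 'M[C]_(m, n)) : R := \sum_i \sum_j sq (A i j).

Lemma adjE m n (A : 'M[C]_(m, n)) i j : adj A i j = conj (A j i).
Proof. by rewrite !mxE. Qed.
Lemma adjmxM m n p (A : 'M[C]_(m, n)) (B : 'M[C]_(n, p)) :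
  adj (A *m B) = adj B *m adj A.
Proof. by rewrite /adj trmx_mul map_mxM. Qed.
Lemma adjmxK m n (A : 'M[C]_(m, n)) : adj (adj A) = A.
Proof. exact: trmxCK. Qed.
Lemma adjmx1 n : adj (1%:M : 'M[C]_n) = 1%:M.
Proof. by rewrite /adj trmx1 map_mx1. Qed.
Lemma adjmxZ m n z (A : 'M[C]_(m, n)) : adj (z *: A) = conj z *: adj A.
Proof. by apply/matrixP=> i j; rewrite !mxE rmorphM. Qed.
Lemma adjmx_sum m n I (r : seq I) (F : I -> 'M[C]_(m, n)) :
  adj (\sum_(i <- r) F i) = \sum_(i <- r) adj (F i).
Proof.
elim/big_ind2: _ => [|A1 A2 B1 B2 <- <-|//]; apply/matrixP=> i j; rewrite !mxE.
  exact: rmorph0.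
exact: rmorphD.
Qed.
Lemma det_adjmx n (A : 'M[C]_n) : \det (adj A) = conj (\det A).
Proof. by rewrite /adj det_map_mx det_tr. Qed.

Lemma fro_ge0 m n (A : 'M[C]_(m, n)) : 0 <= fro A.
Proof. by apply: sumr_ge0 => i _; apply: sumr_ge0 => j _; exact: sq_ge0. Qed.
Lemma froE m n (A : 'M[C]_(m, n)) : (fro A)%:C = \tr (A *m adj A).
Proof.
rewrite /fro /mxtrace rmorph_sum; apply: eq_bigr => i _ /=.
rewrite !mxE rmorph_sum; apply: eq_bigr => j _ /=.
by rewrite adjE sqE.
Qed.
Lemma fro_eq0 m n (A : 'M[C]_(m, n)) : fro A = 0 -> A = 0.
Proof.
move=> /eqP; rewrite psumr_eq0 => [/allP H|i _]; last first.
  by apply: sumr_ge0 => j _; exact: sq_ge0.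
apply/matrixP=> i j; rewrite mxE; have := H i (mem_index_enum _).
rewrite psumr_eq0 => [/allP/(_ j (mem_index_enum _))|j' _]; last exact: sq_ge0.
by rewrite /= sq_eq0 => /eqP.
Qed.
Lemma fro_adj m n (A : 'M[C]_(m, n)) : fro (adj A) = fro A.
Proof. by apply: complexI; rewrite !froE adjmxK mxtrace_mulC. Qed.
Lemma fro_mul_isom m n p (U : 'M[C]_(m, n)) (A : 'M[C]_(n, p)) :
  adj U *m U = 1%:M -> fro (U *m A) = fro A.
Proof.
move=> UU; apply: complexI; rewrite !froE adjmxM mxtrace_mulC.
by rewrite -mulmxA (mulmxA (adj U)) UU mul1mx mxtrace_mulC.
Qed.
Lemma fro_mul_coisom m n p (U : 'M[C]_(n, p)) (A : 'M[C]_(m, n)) :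
  U *m adj U = 1%:M -> fro (A *m U) = fro A.
Proof. by move=> UU; rewrite -fro_adj adjmxM fro_mul_isom ?fro_adj // adjmxK. Qed.
Lemma froZ m n z (A : 'M[C]_(m, n)) : fro (z *: A) = sq z * fro A.
Proof.
rewrite /fro mulr_sumr; apply: eq_bigr => i _; rewrite mulr_sumr.
by apply: eq_bigr => j _; rewrite mxE sqM.
Qed.
Lemma fro2 (A : 'M[C]_2) :
  fro A = sq (A 0 0) + sq (A 0 1) + sq (A 1 0) + sq (A 1 1).
Proof. by rewrite /fro !sum2 !addrA. Qed.

Lemma unitary_mulV n (U : 'M[C]_n) : U \is unitarymx -> U *m adj U = 1%:M.
Proof. by move/unitarymxP. Qed.
Lemma unitary_Vmul n (U : 'M[C]_n) : U \is unitarymx -> adj U *m U = 1%:M.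
Proof. by move/unitarymxP/mulmx1C. Qed.
Lemma adj_unitary n (U : 'M[C]_n) : U \is unitarymx -> adj U \is unitarymx.
Proof. by move=> /unitary_Vmul h; apply/unitarymxP; rewrite -/(adj _) adjmxK. Qed.

Lemma det_unitary n (U : 'M[C]_n) : U \is unitarymx -> cabs (\det U) = 1.
Proof.
move=> /unitary_mulV /(congr1 determinant).
rewrite det_mulmx det1 det_adjmx => h.
have := cabs1; rewrite -h cabsM cabs_conj -expr2 => /eqP.
by rewrite sqrf_eq1 => /orP[/eqP->//|/eqP h']; have := cabs_ge0 (\det U); lra.
Qed.

(* The trace norm: with s1, s2 the singular values of [Q], this is the square
   root of s1^2 + s2^2 + 2 s1 s2. *)
Definition nuc (Q : 'M[C]_2) : R := Num.sqrt (fro Q + 2 * cabs (\det Q)).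

Lemma nuc_ge0 Q : 0 <= nuc Q. Proof. exact: sqrtr_ge0. Qed.
Lemma nuc_arg_ge0 (Q : 'M[C]_2) : 0 <= fro Q + 2 * cabs (\det Q).
Proof. by have := fro_ge0 Q; have := cabs_ge0 (\det Q); lra. Qed.
Lemma nuc_sq Q : nuc Q ^+ 2 = fro Q + 2 * cabs (\det Q).
Proof. by rewrite sqr_sqrtr // nuc_arg_ge0. Qed.
Lemma nuc0 : nuc 0 = 0.
Proof. by rewrite /nuc fro2 det2 !mxE sq0 !mulr0 subrr cabs0 mulr0 !addr0 sqrtr0. Qed.
Lemma nuc_eq0 Q : nuc Q = 0 -> Q = 0.
Proof.
move=> h; apply: fro_eq0; have := nuc_sq Q; rewrite h expr0n /=.
by have := fro_ge0 Q; have := cabs_ge0 (\det Q); lra.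
Qed.
Lemma nuc_unitary (U V Q : 'M[C]_2) :
  U \is unitarymx -> V \is unitarymx -> nuc (U *m Q *m V) = nuc Q.
Proof.
move=> uU uV; rewrite /nuc fro_mul_coisom ?unitary_mulV //.
rewrite fro_mul_isom ?unitary_Vmul // !det_mulmx !cabsM (det_unitary uU).
by rewrite (det_unitary uV) mul1r mulr1.
Qed.
Lemma nucZ z Q : nuc (z *: Q) = cabs z * nuc Q.
Proof.
rewrite /nuc froZ detZ cabsM expr2 cabsM -cabs2 -expr2.
rewrite mulrCA -mulrDr sqrtrM ?sqr_ge0 // sqrtr_sqr ger0_norm //.
exact: cabs_ge0.
Qed.
(** After squaring, this is |Q00 Q11| <= |det Q| + |Q01 Q10| combined with 2 |Q01 Q10| <= |Q01|^2 +
    |Q10|^2. *)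
Lemma diag_le_nuc (Q : 'M[C]_2) : cabs (Q 0 0) + cabs (Q 1 1) <= nuc Q.
Proof.
rewrite -ler_sqr ?nnegrE ?nuc_ge0 ?addr_ge0 ?cabs_ge0 // nuc_sq fro2.
have h : cabs (Q 0 0) * cabs (Q 1 1) <=
         cabs (\det Q) + cabs (Q 0 1) * cabs (Q 1 0).
  rewrite det2 -!cabsM; apply: le_trans (cabsD _ _); rewrite subrK //.
rewrite -!cabs2.
by have := sqr_ge0 (cabs (Q 0 1) - cabs (Q 1 0)); nra.
Qed.
Lemma nuc_diag (Q : 'M[C]_2) : Q 0 1 = 0 -> Q 1 0 = 0 ->
  nuc Q = cabs (Q 0 0) + cabs (Q 1 1).
Proof.
move=> h1 h2; apply/eqP; rewrite -(eqrXn2 (n := 2)) ?nuc_ge0 ?addr_ge0 ?cabs_ge0 //.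
rewrite nuc_sq fro2 det2 h1 h2 sq0 mulr0 subr0 cabsM -!cabs2; apply/eqP; ring.
Qed.
Lemma tr_le_nuc (Q : 'M[C]_2) : cabs (\tr Q) <= nuc Q.
Proof. by rewrite /mxtrace sum2 (le_trans (cabsD _ _)) ?diag_le_nuc. Qed.

Definition mx2 (a b c d : C) : 'M[C]_2 :=
  \matrix_(i, j) if i == 0 then (if j == 0 then a else b)
                 else (if j == 0 then c else d).

(** The general unitary 2x2 matrix with first row (x, y) and determinant [w]. *)
Lemma mx2_unitary x y w : sq x + sq y = 1 -> cabs w = 1 ->
  mx2 x y (- w * conj y) (w * conj x) \is unitarymx.
Proof.
move=> xy w1; apply/unitarymxP.
have h : x * conj x + y * conj y = 1 by rewrite -!sqE -rmorphD /= xy.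
have hw : w * conj w = 1 by rewrite -sqE -cabs2 w1 expr1n.
apply/matrixP; apply: ord2P; apply: ord2P;
  rewrite !mxE sum2 !mxE /= ?rmorphM ?rmorphN /= ?conjCK //.
- ring.
- ring.
transitivity ((w * conj w) * (x * conj x + y * conj y)); first ring.
by rewrite hw h mulr1.
Qed.

(* With [w] the phase of [\det Q], the sum of [Q] and [w] times its conjugate
   cofactor matrix is [nuc Q] times a unitary matrix, the polar factor of [Q]. *)
Lemma nuc_attain_tr (Q : 'M[C]_2) :
  exists2 V, V \is unitarymx & cabs (\tr (adj V *m Q)) = nuc Q.
Proof.
have [w w1 hw] : exists2 w, cabs w = 1 & \det Q = w * (cabs (\det Q))%:C.
  have [->|n0] := eqVneq (\det Q) 0.
    by exists 1; rewrite ?cabs1 ?cabs0 ?mulr0.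
  exists (\det Q / (cabs (\det Q))%:C); last first.
    by rewrite divfK // cabsE normr_eq0.
  apply: complexI; rewrite [LHS]cabsE normrM normfV !cabsE normr_id divff //.
  by rewrite normr_eq0.
have [->|Q0] := eqVneq Q 0.
  exists 1%:M; first by apply/unitarymxP; rewrite -/(adj _) adjmx1 mulmx1.
  by rewrite mulmx0 mxtrace0 cabs0 nuc0.
set r := nuc Q; have r0 : r != 0 by apply: contraNneq Q0 => /nuc_eq0->.
pose x := Q 0 0 + w * conj (Q 1 1); pose y := Q 0 1 - w * conj (Q 1 0).
have ww : w * conj w = 1 by rewrite -sqE -cabs2 w1 expr1n.
have hd : conj w * (Q 0 0 * Q 1 1 - Q 0 1 * Q 1 0) = (cabs (\det Q))%:C.
  by rewrite -det2 [X in _ * X]hw mulrA [conj w * w]mulrC ww mul1r.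
have hd' : w * (conj (Q 0 0) * conj (Q 1 1) - conj (Q 0 1) * conj (Q 1 0)) =
           (cabs (\det Q))%:C.
  have := congr1 conj hd; rewrite rmorphM rmorphB !rmorphM /= conjCK => ->.
  by rewrite conj_Creal //; apply/complex_realP; exists (cabs (\det Q)).
have r2 : (r ^+ 2)%:C = Q 0 0 * conj (Q 0 0) + Q 0 1 * conj (Q 0 1) +
    Q 1 0 * conj (Q 1 0) + Q 1 1 * conj (Q 1 1) + 2 * (cabs (\det Q))%:C.
  by rewrite nuc_sq fro2 !rmorphD !rmorphM /= !sqE rmorph_nat.
have hxy : sq x + sq y = r ^+ 2.
  apply: complexI; rewrite rmorphD /= !sqE r2 /x /y !(rmorphD, rmorphN, rmorphM) /=.
  rewrite !conjCK [2 * _](mulr_natl _ 2) mulr2n -{1}hd -hd'.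
  by transitivity (Q 0 0 * conj (Q 0 0) + Q 0 1 * conj (Q 0 1) +
    (w * conj w) * (Q 1 0 * conj (Q 1 0) + Q 1 1 * conj (Q 1 1)) +
   (conj w * (Q 0 0 * Q 1 1 - Q 0 1 * Q 1 0) +
     w * (conj (Q 0 0) * conj (Q 1 1) - conj (Q 0 1) * conj (Q 1 0))));
    [ring|rewrite ww; ring].
pose s := (r^-1)%:C.
have cs : conj s = s by rewrite conj_Creal //; apply/complex_realP; exists r^-1.
exists (mx2 (s * x) (s * y) (- w * conj (s * y)) (w * conj (s * x))).
  apply: mx2_unitary => //; rewrite !sqM -mulrDr hxy.
  by rewrite -cabs2 cabs_real ?invr_ge0 ?nuc_ge0 // -exprMn mulVf ?expr1n.
suff -> : \tr (adj (mx2 (s * x) (s * y) (- w * conj (s * y)) (w * conj (s * x)))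
    *m Q) = r%:C by rewrite cabs_real // nuc_ge0.
have -> : r%:C = s * (r ^+ 2)%:C.
  by rewrite -rmorphM /= expr2 mulKf.
rewrite r2 /mxtrace sum2 !mxE !sum2 !mxE /= !(rmorphM, rmorphN) /= !conjCK !cs.
rewrite /x /y !(rmorphD, rmorphN, rmorphM) /= !conjCK -hd.
transitivity (s * (Q 0 0 * conj (Q 0 0) + Q 0 1 * conj (Q 0 1) +
    (w * conj w) * (Q 1 0 * conj (Q 1 0) + Q 1 1 * conj (Q 1 1)) +
   2 * (conj w * (Q 0 0 * Q 1 1 - Q 0 1 * Q 1 0)))); [ring|rewrite ww; ring].
Qed.

(* Up to phases on the diagonal, this is Takagi's factorisation.  The first row
   of [U] is a coneigenvector, i.e. [v *m Q] is a multiple of [conj v]: if [v] is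
   an eigenvector of [Q *m conj Q] for s^2, take [conj (v *m Q) + s *: v], or [v]
   itself when this vanishes. *)
Lemma takagi (Q : 'M[C]_2) : Q^T = Q ->
  exists2 U : 'M[C]_2, U \is unitarymx &
    (U *m Q *m U^T) 0 1 = 0 /\ (U *m Q *m U^T) 1 0 = 0.
Proof.
move=> symQ.
have [v v0 [t vQ]] : exists2 v : 'rV[C]_2, v != 0 &
    exists t, v *m Q = t *: map_mx conj v.
  pose Qc := map_mx conj Q.
  have [a /eigenvalueP[v va v0]] := eigenvalue_closed (Q *m Qc) (isT : (0 < 2)%N).
  pose s := sqrtC a.
  have adQ : adj Q = Qc by rewrite /adj symQ.
  (* Since [Q] is symmetric, [Q *m Qc] is [Q *m adj Q], and therefore a |v|^2 = |v Q|^2. *)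
  have a0 : 0 <= a.
    have h : a * (fro v)%:C = (fro (v *m Q))%:C.
      by rewrite !froE adjmxM adQ !mulmxA -(mulmxA v) va -scalemxAl mxtraceZ.
    have fv : 0 < fro v.
      by rewrite lt_def fro_ge0 andbT; apply: contraNneq v0 => /fro_eq0->.
    rewrite -(pmulr_lge0 _ (x := (fro v)%:C)) ?ltr0c //; last by rewrite ltcR.
    by rewrite h ler0c fro_ge0.
  have cs : conj s = s by rewrite conj_Creal // ger0_real // sqrtC_ge0.
  have cQc : map_mx conj Qc = Q.
    by apply/matrixP=> i j; rewrite !mxE conjCK.
  have cv (u : 'rV[C]_2) : map_mx conj (map_mx conj u) = u.
    by apply/matrixP=> i j; rewrite !mxE conjCK.
  have sa : s * s = a by rewrite -expr2 sqrtCK.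
  pose w := map_mx conj (v *m Q) + s *: v.
  have [w0|w0] := eqVneq w 0.
    exists v => //; exists (- s).
    have /(congr1 (map_mx conj)) : map_mx conj (v *m Q) = - (s *: v).
      by apply/eqP; rewrite -addr_eq0; apply/eqP.
    rewrite cv => ->; apply/matrixP=> i j; rewrite !mxE rmorphN rmorphM /= cs.
    by rewrite mulNr.
  exists w => //; exists s; rewrite /w mulmxDl.
  have -> : map_mx conj (v *m Q) *m Q = a *: map_mx conj v.
    rewrite -{2}cQc -map_mxM -mulmxA va.
    apply/matrixP=> i j; rewrite !mxE rmorphM /=; congr (_ * _).
    by rewrite conj_Creal // ger0_real.
  apply/matrixP=> i j; rewrite -scalemxAl !mxE rmorphD rmorphM /= conjCK cs.
  by rewrite -sa; ring.
have fv : fro v = sq (v 0 0) + sq (v 0 1) by rewrite /fro big_ord1 sum2.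
have fv0 : fro v != 0 by apply: contraNneq v0 => /fro_eq0->.
pose s := ((Num.sqrt (fro v))^-1)%:C.
have cs : conj s = s.
  by rewrite conj_Creal //; apply/complex_realP; exists (Num.sqrt (fro v))^-1.
have v1 : sq (s * v 0 0) + sq (s * v 0 1) = 1.
  rewrite !sqM -mulrDr -fv -cabs2 cabs_real ?invr_ge0 ?sqrtr_ge0 //.
  by rewrite exprVn sqr_sqrtr ?fro_ge0 // mulVf.
(* The second row pairs to zero, bilinearly, with the conjugate of [v]. As [v *m Q] is a multiple of
   that conjugate, the off-diagonal entry vanishes. *)
pose U := mx2 (s * v 0 0) (s * v 0 1)
           (- 1 * conj (s * v 0 1)) (1 * conj (s * v 0 0)).
have uU : U \is unitarymx by apply: mx2_unitary; rewrite ?cabs1.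
have h01 : (U *m Q *m U^T) 0 1 = 0.
  have h j : v 0 0 * Q 0 j + v 0 1 * Q 1 j = t * conj (v 0 j).
    by have /matrixP/(_ 0 j) := vQ; rewrite !mxE sum2.
  rewrite !mxE !sum2 !mxE !sum2 !mxE /= !rmorphM /= cs.
  transitivity (s ^+ 2 * (- conj (v 0 1) * (v 0 0 * Q 0 0 + v 0 1 * Q 1 0)
      + conj (v 0 0) * (v 0 0 * Q 0 1 + v 0 1 * Q 1 1))); first ring.
  by rewrite !h; ring.
exists U => //; split=> //.
have <- : (U *m Q *m U^T)^T = U *m Q *m U^T.
  by rewrite !trmx_mul trmxK symQ mulmxA.
by rewrite mxE.
Qed.

End ComplexMatrices.

(** * Contraction of the trace norm and of determinants under Kraus families *)

Section TraceNorm.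
Variable R : realType.
Local Notation C := R[i].
Local Notation conj := (@Num.conj C).

Definition kraus n (M : 'I_n -> 'M[C]_2) : Prop :=
  \sum_s adj (M s) *m M s = 1%:M.

Definition colsq m n (A : 'M[C]_(m, n)) (a : 'I_n) : R := \sum_t sq (A t a).

Lemma colsqE m n (A : 'M[C]_(m, n)) a : (colsq A a)%:C = (adj A *m A) a a.
Proof.
rewrite /colsq rmorph_sum mxE; apply: eq_bigr => t _ /=.
by rewrite sqE adjE mulrC.
Qed.

Lemma colsq_unitary n p (U : 'M[C]_n) (A : 'M[C]_(n, p)) a :
  U \is unitarymx -> colsq (U *m A) a = colsq A a.
Proof.
move=> uU; apply: complexI; rewrite !colsqE adjmxM mulmxA -(mulmxA (adj A)).
by rewrite unitary_Vmul // mulmx1.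
Qed.

Lemma sandwich_diag (N D : 'M[C]_2) t : D 0 1 = 0 -> D 1 0 = 0 ->
  cabs ((N *m D *m N^T) t t) <= \sum_a cabs (D a a) * sq (N t a).
Proof.
move=> h1 h2; rewrite !mxE !sum2 !mxE !sum2 h1 h2 !mulr0 addr0 add0r.
apply: le_trans (cabsD _ _) _; rewrite !cabsM -!cabs2.
lra.
Qed.

(** N D N^T is the sum over a of D_aa times the symmetric rank-one matrix built from column a of N,
    whose trace norm is the squared norm of that column. The triangle inequality is obtained from
    Takagi's basis for N D N^T: there [nuc] is a sum of moduli of diagonal entries, and the unitary
    leaves the column norms of N unchanged. *)
Lemma nuc_sandwich_diag (N D : 'M[C]_2) : D 0 1 = 0 -> D 1 0 = 0 ->
  nuc (N *m D *m N^T) <= \sum_a cabs (D a a) * colsq N a.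
Proof.
move=> h1 h2.
have symD : D^T = D.
  by apply/matrixP; apply: ord2P; apply: ord2P; rewrite !mxE ?h1 ?h2.
have symN : (N *m D *m N^T)^T = N *m D *m N^T.
  by rewrite !trmx_mul trmxK symD mulmxA.
have [V uV [d1 d2]] := takagi symN.
have uVT : V^T \is unitarymx by rewrite trmx_unitary.
rewrite -(nuc_unitary _ uV uVT) nuc_diag //.
have -> : V *m (N *m D *m N^T) *m V^T = (V *m N) *m D *m (V *m N)^T.
  by rewrite trmx_mul !mulmxA.
apply: le_trans (lerD (sandwich_diag _ 0 h1 h2) (sandwich_diag _ 1 h1 h2)) _.
rewrite -(sum2 (fun t => \sum_a cabs (D a a) * sq ((V *m N) t a))) exchange_big.
apply: ler_sum => a _; rewrite -(colsq_unitary N a uV) /colsq mulr_sumr.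
by [].
Qed.

(* In a basis diagonalising [Q], the trace norm is a sum over rank-one terms,
   each of which is preserved on average. *)
Lemma nuc_contract n (M : 'I_n -> 'M[C]_2) (Q : 'M[C]_2) :
  kraus M -> Q^T = Q -> \sum_s nuc (M s *m Q *m (M s)^T) <= nuc Q.
Proof.
move=> kM symQ; have [U uU [d1 d2]] := takagi symQ.
have uUT : U^T \is unitarymx by rewrite trmx_unitary.
pose D := U *m Q *m U^T; pose N s := M s *m adj U.
have eQ s : M s *m Q *m (M s)^T = N s *m D *m (N s)^T.
  rewrite /N /D trmx_mul !mulmxA -[M s *m adj U *m U]mulmxA unitary_Vmul // mulmx1.
  suff h : U^T *m (adj U)^T = 1%:M by rewrite -(mulmxA _ U^T) h mulmx1.
  by rewrite -trmx_mul unitary_Vmul // trmx1.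
rewrite -[leRHS](nuc_unitary _ uU uUT) [leRHS]nuc_diag // -/D.
rewrite (eq_bigr _ (fun s _ => congr1 (@nuc R) (eQ s))).
apply: le_trans (ler_sum _ (fun s _ => nuc_sandwich_diag (N s) d1 d2)) _.
rewrite exchange_big -(sum2 (fun a => cabs (D a a))) /=.
apply: ler_sum => a _; rewrite -mulr_sumr -[leRHS]mulr1; apply: ler_wpM2l.
  exact: cabs_ge0.
rewrite le_eqVlt; apply/orP; left; apply/eqP/complexI.
rewrite rmorph_sum /= (eq_bigr _ (fun s _ => colsqE (N s) a)) -summxE.
have -> : \sum_s adj (N s) *m N s = 1%:M.
  rewrite /N (eq_bigr (fun s => U *m (adj (M s) *m M s) *m adj U)).
    by rewrite -mulmx_suml -mulmx_sumr kM mulmx1 unitary_mulV.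
  by move=> s _; rewrite adjmxM adjmxK !mulmxA.
by rewrite mxE eqxx.
Qed.

(** In singular values, 2 s1 s2 <= s1^2 + s2^2. *)
Lemma det_le_fro (A : 'M[C]_2) : 2 * cabs (\det A) <= fro A.
Proof.
rewrite fro2 det2.
apply: le_trans (ler_wpM2l _ (cabsB _ _)) _ => //; rewrite !cabsM -!cabs2.
have := sqr_ge0 (cabs (A 0 0) - cabs (A 1 1)).
by have := sqr_ge0 (cabs (A 0 1) - cabs (A 1 0)); nra.
Qed.

(** The traces of [adj (M s) *m M s] add up to 2, and each dominates 2 |det (M s)|. This is the
    contraction factor when a party of the pair itself measures. *)
Lemma det_kraus n (M : 'I_n -> 'M[C]_2) :
  kraus M -> \sum_s cabs (\det (M s)) <= 1.
Proof.
move=> kM; suff: 2 * \sum_s cabs (\det (M s)) <= 2 by lra.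
rewrite mulr_sumr; apply: le_trans (ler_sum _ (fun s _ => det_le_fro (M s))) _.
rewrite le_eqVlt; apply/orP; left; apply/eqP/complexI.
rewrite rmorph_sum /= (eq_bigr (fun s => \tr (adj (M s) *m M s))).
  by rewrite -raddf_sum kM /= mxtrace1 rmorph_nat.
by move=> s _; rewrite froE mxtrace_mulC.
Qed.

End TraceNorm.

(** * Relabelling of parties, slices of the amplitude tensor and the polarised determinant *)

Lemma party_ind (P : 'I_3 -> Prop) :
  P partyA -> P partyB -> P partyC -> forall l, P l.
Proof.
move=> pA pB pC [[|[|[|//]]] Hl]; [move: pA|move: pB|move: pC];
  by congr P; apply/val_inj.
Qed.

Definition distinct (i j k : 'I_3) := [&& i != j, k != i & k != j].

(** Reduces a claim about parties in arbitrary order to six closed instances, in which the equality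
    tests on parties compute. *)
Lemma distinct_ind (P : 'I_3 -> 'I_3 -> 'I_3 -> Prop) :
  P partyA partyB partyC -> P partyA partyC partyB ->
  P partyB partyA partyC -> P partyB partyC partyA ->
  P partyC partyA partyB -> P partyC partyB partyA ->
  forall i j k, distinct i j k -> P i j k.
Proof.
by move=> P1 P2 P3 P4 P5 P6; apply: party_ind; apply: party_ind; exact: party_ind.
Qed.

Lemma ket_index_ext b b' : b partyA = b' partyA -> b partyB = b' partyB ->
  b partyC = b' partyC -> ket_index b = ket_index b'.
Proof. by rewrite /ket_index => -> -> ->. Qed.

Lemma sum_tens (V : nmodType) m n (F : 'I_(m * n) -> V) :
  \sum_x F x = \sum_a \sum_b F (mxtens_index (a, b)).
Proof.
rewrite pair_big /= (reindex (@mxtens_index m n)) /=.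
  by apply: eq_bigr => -[a b] _.
by exists (@mxtens_unindex m n) => x _; rewrite (mxtens_indexK, mxtens_unindexK).
Qed.

Definition upd (b : 'I_3 -> 'I_2) k s l := if l == k then s else b l.

Section Slices.
Variable R : realType.
Local Notation C := R[i].
Local Notation conj := (@Num.conj C).
Implicit Types psi : 'cV[C]_(2 * 2 * 2).

Lemma at_partyE k (M : 'M[C]_2) n (psi : 'M[C]_(2 * 2 * 2, n)) b c :
  (at_party k M *m psi) (ket_index b) c =
  \sum_s M (b k) s * psi (ket_index (upd b k s)) c.
Proof.
rewrite mxE sum_tens sum_tens /at_party /local_op /ket_index /upd.
have d (x y : 'I_2) : (1%:M : 'M[C]_2) x y = (x == y)%:R by rewrite mxE.
move: k; apply: party_ind => /=; rewrite !sum2 !tensmxE !d;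
  move: (b partyA) (b partyB) (b partyC); apply: ord2P; apply: ord2P;
  by apply: ord2P; rewrite /= ?(mul0r, mulr0, mulr1, mul1r, add0r, addr0).
Qed.

Definition slice i j psi t : 'M[C]_2 :=
  \matrix_(a, b) psi (split_index i j (mxtens_index (a, b)) t) ord0.

Definition bits (i j : 'I_3) (a b t : 'I_2) l : 'I_2 :=
  if l == i then a else if l == j then b else t.

Lemma split_indexE i j a b t :
  split_index i j (mxtens_index (a, b)) t = ket_index (bits i j a b t).
Proof. by apply: ket_index_ext; rewrite /bits mxtens_indexK. Qed.

Lemma sliceE i j psi t a b :
  slice i j psi t a b = psi (ket_index (bits i j a b t)) ord0.
Proof. by rewrite mxE split_indexE. Qed.

Lemma slice_measured i j k (M : 'M[C]_2) psi t : distinct i j k ->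
  slice i j (at_party k M *m psi) t = \sum_s M t s *: slice i j psi s.
Proof.
move=> dis; apply/matrixP=> a b; rewrite sliceE at_partyE summxE.
apply: eq_bigr => s _; rewrite mxE sliceE; move: i j k dis.
by apply: distinct_ind; congr (_ * psi _ _); apply: ket_index_ext.
Qed.

Lemma slice_fst i j k (M : 'M[C]_2) psi t : distinct i j k ->
  slice i j (at_party i M *m psi) t = M *m slice i j psi t.
Proof.
move=> dis; apply/matrixP=> a b; rewrite sliceE at_partyE mxE.
apply: eq_bigr => s _; rewrite sliceE; move: i j k dis.
by apply: distinct_ind; congr (_ * psi _ _); apply: ket_index_ext.
Qed.

Lemma slice_snd i j k (M : 'M[C]_2) psi t : distinct i j k ->
  slice i j (at_party j M *m psi) t = slice i j psi t *m M^T.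
Proof.
move=> dis; apply/matrixP=> a b; rewrite sliceE at_partyE mxE.
apply: eq_bigr => s _; rewrite sliceE [M^T _ _]mxE mulrC; move: i j k dis.
by apply: distinct_ind; congr (psi _ _ * _); apply: ket_index_ext.
Qed.

Definition pdet (X Y : 'M[C]_2) : C :=
  (X 0 0 * Y 1 1 + X 1 1 * Y 0 0 - X 0 1 * Y 1 0 - X 1 0 * Y 0 1) / 2.

Lemma pdet_det X : pdet X X = \det X.
Proof. by rewrite det2 /pdet; field. Qed.

Lemma pdetC X Y : pdet X Y = pdet Y X.
Proof. by rewrite /pdet; congr (_ / _); ring. Qed.

Lemma pdet_mull M X Y : pdet (M *m X) (M *m Y) = \det M * pdet X Y.
Proof. by rewrite det2 /pdet !mxE !sum2; field. Qed.

Lemma pdet_mulr M X Y : pdet (X *m M) (Y *m M) = \det M * pdet X Y.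
Proof. by rewrite det2 /pdet !mxE !sum2; field. Qed.

(** The matrix of the quadratic form that sends x to the determinant of the combination of the two
    slices with coefficients x. Its determinant is -1/4 times Cayley's hyperdeterminant of the
    amplitudes. *)
Definition qform i j psi : 'M[C]_2 :=
  \matrix_(s, t) pdet (slice i j psi s) (slice i j psi t).

Lemma qform_sym i j psi : (qform i j psi)^T = qform i j psi.
Proof. by apply/matrixP=> s t; rewrite !mxE pdetC. Qed.

Lemma pdet_lin (A : 'I_2 -> 'M[C]_2) (x y : 'I_2 -> C) :
  pdet (\sum_s x s *: A s) (\sum_t y t *: A t) =
  \sum_t (\sum_s x s * pdet (A s) (A t)) * y t.
Proof. by rewrite !sum2 /pdet !mxE; field. Qed.

Lemma qform_measured i j k M psi : distinct i j k ->
  qform i j (at_party k M *m psi) = M *m qform i j psi *m M^T.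
Proof.
move=> dis; apply/matrixP=> s t; rewrite mxE !(slice_measured _ _ _ dis).
rewrite pdet_lin mxE; apply: eq_bigr => t' _; rewrite !mxE; congr (_ * _).
by apply: eq_bigr => s' _; rewrite !mxE.
Qed.

Lemma qform_fst i j k M psi : distinct i j k ->
  qform i j (at_party i M *m psi) = \det M *: qform i j psi.
Proof.
by move=> dis; apply/matrixP=> s t; rewrite !mxE !(slice_fst _ _ _ dis) pdet_mull.
Qed.

Lemma qform_snd i j k M psi : distinct i j k ->
  qform i j (at_party j M *m psi) = \det M *: qform i j psi.
Proof.
move=> dis; apply/matrixP=> s t.
by rewrite !mxE !(slice_snd _ _ _ dis) pdet_mulr det_tr.
Qed.

Lemma qformZ i j z psi : qform i j (z *: psi) = z ^+ 2 *: qform i j psi.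
Proof.
apply/matrixP=> s t; rewrite !mxE.
have e u : slice i j (z *: psi) u = z *: slice i j psi u.
  by apply/matrixP=> a b; rewrite !mxE.
by rewrite !e /pdet !mxE; field.
Qed.

End Slices.

(* On unit vectors this is [3 F_ij - 2] (lemma [teleE]); unlike [tele] it is
   homogeneous of degree two.  Locked to keep unification from comparing the
   amplitude tables of different pairs of parties. *)
HB.lock Definition tangle (R : realType) (i j : 'I_3)
    (psi : 'cV[R[i]]_(2 * 2 * 2)) : R := 2 * nuc (qform i j psi).

Section Tangle.
Variable R : realType.
Local Notation C := R[i].
Implicit Types psi : 'cV[C]_(2 * 2 * 2).

Lemma tangle_ge0 i j psi : 0 <= tangle i j psi.
Proof. by rewrite tangle.unlock mulr_ge0 ?nuc_ge0. Qed.

Lemma tangleZ i j z psi : tangle i j (z *: psi) = sq z * tangle i j psi.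
Proof. by rewrite tangle.unlock qformZ nucZ expr2 cabsM -expr2 cabs2 mulrCA. Qed.

Lemma tangle_kraus i j k l n (M : 'I_n -> 'M[C]_2) psi :
  distinct i j k -> kraus M ->
  \sum_s tangle i j (at_party l (M s) *m psi) <= tangle i j psi.
Proof.
move=> dis kM; rewrite tangle.unlock -mulr_sumr ler_pM2l //.
have : [|| l == k, l == i | l == j].
  by move: i j k dis; apply: distinct_ind; move: l; apply: party_ind.
case/or3P => /eqP->.
- under eq_bigr do rewrite (qform_measured _ _ dis).
  by apply: nuc_contract => //; exact: qform_sym.
- under eq_bigr do rewrite (qform_fst _ _ dis) nucZ.
  by rewrite -mulr_suml -[leRHS]mul1r ler_wpM2r ?nuc_ge0 // det_kraus.
- under eq_bigr do rewrite (qform_snd _ _ dis) nucZ.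
  by rewrite -mulr_suml -[leRHS]mul1r ler_wpM2r ?nuc_ge0 // det_kraus.
Qed.

End Tangle.

(** * Teleportation fidelity of pure states *)

Lemma sup_attained (R : realType) (S : set R) (m : R) :
  S m -> (forall x, S x -> x <= m) -> sup S = m.
Proof.
move=> Sm ub; apply/eqP; rewrite eq_le ge_sup //=; last by exists m.
by apply: sup_upper_bound => //; split; exists m.
Qed.

Section Teleportation.
Variable R : realType.
Local Notation C := R[i].
Local Notation conj := (@Num.conj C).
Implicit Types psi : 'cV[C]_(2 * 2 * 2).

Definition mat4 (phi : 'cV[C]_(2 * 2)) : 'M[C]_2 :=
  \matrix_(a, b) phi (mxtens_index (a, b)) ord0.

Lemma projectorE n (phi : 'cV[C]_n) a b :
  projector phi a b = phi a ord0 * conj (phi b ord0).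
Proof. by rewrite mxE big_ord1 adjE. Qed.

Lemma reduce_fstE phi :
  reduce_fst (projector phi) = mat4 phi *m adj (mat4 phi).
Proof.
apply/matrixP=> a b; rewrite !mxE; apply: eq_bigr => t _.
by rewrite projectorE adjE !mxE.
Qed.

Lemma reduce_sndE phi :
  reduce_snd (projector phi) = ((adj (mat4 phi) *m mat4 phi))^T.
Proof.
apply/matrixP=> a b; rewrite !mxE; apply: eq_bigr => t _.
by rewrite projectorE adjE !mxE mulrC.
Qed.

Lemma fro_mat4 phi : fro (mat4 phi) = fro phi.
Proof.
rewrite /fro [RHS]sum_tens; apply: eq_bigr => a _; apply: eq_bigr => b _.
by rewrite big_ord1 mxE.
Qed.

Lemma unit_vectorE n (v : 'cV[C]_n) : unit_vector v <-> fro v = 1.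
Proof.
have e : (adj v *m v) ord0 ord0 = (fro v)%:C.
  by rewrite froE mxtrace_mulC /mxtrace big_ord1.
by rewrite /unit_vector e; split=> [/(@complexI R)|->].
Qed.

Lemma sqr_sqrt2 : Num.sqrt 2 ^+ 2 = 2 :> R.
Proof. by rewrite sqr_sqrtr. Qed.

Lemma conj_realc (x : R) : conj x%:C = x%:C.
Proof. by rewrite conj_Creal //; apply/complex_realP; exists x. Qed.

(** A maximally mixed marginal says that the amplitude matrix times its adjoint is I/2. Maximally
    entangled vectors thus correspond to unitary matrices divided by sqrt 2, and the fully entangled
    fraction becomes a maximum over unitaries. *)
Lemma max_entangled_unitary e : max_entangled e ->
  (Num.sqrt 2)%:C *: mat4 e \is unitarymx.
Proof.
case=> _ + _; rewrite reduce_fstE => he; apply/unitarymxP; rewrite -/(adj _).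
rewrite adjmxZ conj_realc -scalemxAr -scalemxAl he scalerA -rmorphM -expr2.
by rewrite sqr_sqrt2 scale_scalar_mx rmorph_nat divff ?pnatr_eq0.
Qed.

Lemma unitary_max_entangled (V : 'M[C]_2) : V \is unitarymx ->
  exists2 e, max_entangled e & mat4 e = ((Num.sqrt 2)^-1)%:C *: V.
Proof.
move=> uV; pose c : C := ((Num.sqrt 2)^-1)%:C.
have cc : c * conj c = 2%:R^-1.
  by rewrite conj_realc -rmorphM -expr2 exprVn sqr_sqrt2 fmorphV rmorph_nat.
pose e : 'cV[C]_(2 * 2) :=
  \matrix_(x, _) (c * V (mxtens_unindex x).1 (mxtens_unindex x).2).
have me : mat4 e = c *: V.
  by apply/matrixP=> a b; rewrite !mxE mxtens_indexK.
exists e => //; split.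
- apply/unit_vectorE/complexI; rewrite -fro_mat4 me froZ rmorphM /= sqE cc.
  rewrite froE unitary_mulV // mxtrace1 mulVf ?pnatr_eq0 //.
- rewrite reduce_fstE me adjmxZ -scalemxAr -scalemxAl scalerA mulrC cc.
  by rewrite unitary_mulV // scalemx1.
- rewrite reduce_sndE me adjmxZ -scalemxAr -scalemxAl scalerA cc.
  by rewrite unitary_Vmul // scalemx1 tr_scalar_mx.
Qed.

Lemma overlapE e phi : (adj e *m phi) 0 0 = \tr (adj (mat4 e) *m mat4 phi).
Proof.
rewrite mxE sum_tens exchange_big; apply: eq_bigr => b _; rewrite mxE.
by apply: eq_bigr => a _; rewrite !adjE !mxE.
Qed.

Lemma expval_projector n c (phi e : 'cV[C]_n) :
  expval (c%:C *: projector phi) e = c * sq ((adj e *m phi) 0 0).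
Proof.
rewrite /expval -scalemxAr -scalemxAl mxE /projector.
rewrite mulmxA -[_ *m _ *m e]mulmxA mxE big_ord1.
rewrite -[adj phi *m e]adjmxK adjmxM adjmxK (adjE (adj e *m phi)) -sqE -rmorphM.
by [].
Qed.

(** The overlap with the vector of V / sqrt 2 is tr (V^* X) / sqrt 2, where X is the amplitude
    matrix of [phi]; the largest |tr (V^* X)| over unitary V is the trace norm of X. The factor [c]
    will be the inverse of an outcome probability, possibly [0^-1 = 0]. *)
Lemma entangled_fractionE c phi : 0 <= c ->
  entangled_fraction (c%:C *: projector phi) = c * (nuc (mat4 phi) ^+ 2 / 2).
Proof.
move=> c0; apply: sup_attained.
  have [V uV hV] := nuc_attain_tr (mat4 phi).
  have [e he me] := unitary_max_entangled uV; exists e => //.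
  rewrite expval_projector overlapE me adjmxZ conj_realc -scalemxAl mxtraceZ.
  rewrite sqM -!cabs2 hV cabs_real ?invr_ge0 ?sqrtr_ge0 //.
  by rewrite exprVn sqr_sqrt2 [_ / 2]mulrC.
move=> _ [e /max_entangled_unitary uV ->].
rewrite expval_projector overlapE; apply: ler_wpM2l => //.
set V := _ *: mat4 e in uV.
have -> : mat4 e = ((Num.sqrt 2)^-1)%:C *: V.
  rewrite /V scalerA -rmorphM mulVf ?scale1r // -sqrf_eq0 sqr_sqrt2.
  by rewrite pnatr_eq0.
rewrite adjmxZ conj_realc -scalemxAl mxtraceZ sqM -!cabs2.
rewrite cabs_real ?invr_ge0 ?sqrtr_ge0 // exprVn sqr_sqrt2 [leRHS]mulrC.
rewrite ler_pM2l ?invr_gt0 // ler_sqr ?nnegrE ?nuc_ge0 ?cabs_ge0 //.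
apply: le_trans (tr_le_nuc _) _.
have u1 : (1%:M : 'M[C]_2) \is unitarymx.
  by apply/unitarymxP; rewrite -/(adj _) adjmx1 mulmx1.
by rewrite -[X in nuc X]mulmx1 (nuc_unitary _ (adj_unitary uV) u1).
Qed.

(** The unnormalised amplitude matrix left to i and j when the third party finds outcome t. *)
Definition measured_slice i j psi (U : 'M[C]_2) t : 'M[C]_2 :=
  \sum_s U t s *: slice i j psi s.

Lemma outcome_probE i j psi (U : 'M[C]_2) t :
  outcome_prob i j (projector psi) U t = fro (measured_slice i j psi U t).
Proof.
pose W : 'M[C]_(2, 2 * 2) := \matrix_(s, r) psi (split_index i j r s) ord0.
have eW : reduce_third i j (projector psi) = W *m adj W.
  apply/matrixP=> s s'; rewrite !mxE; apply: eq_bigr => r _.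
  by rewrite projectorE adjE !mxE.
rewrite /outcome_prob eW mulmxA -mulmxA -adjmxM mxE.
suff -> : \sum_r (U *m W) t r * adj (U *m W) r t =
    (fro (measured_slice i j psi U t))%:C by [].
rewrite sum_tens /fro rmorph_sum; apply: eq_bigr => a _ /=.
rewrite rmorph_sum; apply: eq_bigr => b _ /=.
rewrite adjE -sqE /measured_slice summxE mxE; congr (sq _)%:C.
by apply: eq_bigr => s _; rewrite !mxE.
Qed.

Definition unmat4 (A : 'M[C]_2) : 'cV[C]_(2 * 2) :=
  \col_r A (mxtens_unindex r).1 (mxtens_unindex r).2.

Lemma unmat4K A : mat4 (unmat4 A) = A.
Proof. by apply/matrixP=> a b; rewrite !mxE mxtens_indexK. Qed.

Lemma reduce_pairE i j psi :
  reduce_pair i j (projector psi) =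
  \sum_t projector (unmat4 (slice i j psi t)).
Proof.
apply/matrixP=> r s; rewrite summxE mxE; apply: eq_bigr => t _.
case: (mxtens_indexP r) => a b; case: (mxtens_indexP s) => a' b'.
by rewrite !projectorE !mxE !mxtens_indexK.
Qed.

Lemma projector_mul m n (K : 'M[C]_(m, n)) (v : 'cV[C]_n) :
  projector (K *m v) = K *m projector v *m adj K.
Proof. by rewrite /projector adjmxM !mulmxA. Qed.

Lemma projectorZ n z (v : 'cV[C]_n) :
  projector (z *: v) = (sq z)%:C *: projector v.
Proof. by rewrite /projector adjmxZ -scalemxAr -scalemxAl scalerA sqE mulrC. Qed.

Lemma unmat4Z z A : unmat4 (z *: A) = z *: unmat4 A.
Proof. by apply/matrixP=> r s; rewrite !mxE. Qed.

(** The projection leaves party k in a product state, so all slices become multiples of the single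
    matrix [A], with coefficients [conj (U t c)]. Tracing out k adds up their squared moduli, which
    give 1 because row t of [U] is a unit vector. *)
Lemma outcome_stateE i j k psi (U : 'M[C]_2) t : distinct i j k ->
  U \is unitarymx ->
  outcome_state i j k (projector psi) U t =
  ((outcome_prob i j (projector psi) U t)^-1)%:C *:
    projector (unmat4 (measured_slice i j psi U t)).
Proof.
move=> dis uU; rewrite /outcome_state -projector_mul reduce_pairE.
congr (_ *: _); set A := measured_slice _ _ _ _ _.
have e c : slice i j (at_party k (projector (col t (adj U))) *m psi) c =
    conj (U t c) *: A.
  rewrite (slice_measured _ _ _ dis) /A /measured_slice scaler_sumr.
  apply: eq_bigr => s _; rewrite projectorE !mxE conjCK scalerA.
  by [].
under eq_bigr do rewrite e unmat4Z projectorZ sq_conj.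
rewrite -scaler_suml -rmorph_sum /=.
suff -> : \sum_c sq (U t c) = 1 by rewrite scale1r.
apply: complexI; rewrite rmorph_sum /=.
have /matrixP/(_ t t) := unitary_mulV uU; rewrite !mxE eqxx => h.
by apply: etrans h; apply: eq_bigr => s _; rewrite sqE adjE.
Qed.

Lemma fro_measured i j k psi (U : 'M[C]_2) : distinct i j k ->
  U \is unitarymx -> \sum_t fro (measured_slice i j psi U t) = fro psi.
Proof.
move=> dis uU.
have e (phi : 'cV[C]_(2 * 2 * 2)) : \sum_t fro (slice i j phi t) = fro phi.
  have -> : fro phi = \sum_a \sum_b \sum_c
     sq (phi (mxtens_index (mxtens_index (a, b), c)) ord0).
    rewrite /fro; under eq_bigr do rewrite big_ord1.
    by rewrite sum_tens sum_tens.
  rewrite !sum2 !fro2 !sliceE.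
  move: i j k dis; apply: distinct_ind; rewrite /bits /ket_index /=; ring.
under eq_bigr do rewrite /measured_slice -(slice_measured U psi _ dis).
rewrite e fro_mul_isom //.
have tens1 m n : (1%:M : 'M[C]_m) *t (1%:M : 'M[C]_n) = 1%:M.
  apply/matrixP=> x y; case: (mxtens_indexP x) => a b.
  case: (mxtens_indexP y) => a' b'; rewrite tensmxE !mxE.
  rewrite (inj_eq (can_inj (@mxtens_indexK m n))) xpair_eqE -natrM mulnb //.
have adjT m n (A : 'M[C]_m) (B : 'M[C]_n) : adj (A *t B) = adj A *t adj B.
  by rewrite /adj trmx_tens map_mxT.
rewrite /at_party /local_op; case: (_ == k); case: (_ == k); case: (_ == k);
  rewrite !adjT !tensmx_mul ?adjmx1 ?mulmx1 ?unitary_Vmul //;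
  by rewrite !tens1.
Qed.

Lemma det_measured i j k psi (U : 'M[C]_2) t : distinct i j k ->
  \det (measured_slice i j psi U t) = (U *m qform i j psi *m U^T) t t.
Proof.
move=> dis; rewrite -(qform_measured _ _ dis) mxE pdet_det.
by rewrite (slice_measured _ _ _ dis).
Qed.

Lemma assisted_fractionE i j k psi : distinct i j k -> fro psi = 1 ->
  assisted_fraction i j k (projector psi) = 1 / 2 + nuc (qform i j psi).
Proof.
move=> dis psi1.
have val (U : 'M[C]_2) : U \is unitarymx ->
  \sum_t outcome_prob i j (projector psi) U t *
    entangled_fraction (outcome_state i j k (projector psi) U t) =
  1 / 2 + \sum_t cabs ((U *m qform i j psi *m U^T) t t).
  move=> uU.
  have -> : 1 / 2 = \sum_t fro (measured_slice i j psi U t) / 2.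
    by rewrite -mulr_suml (fro_measured _ dis uU) psi1.
  rewrite -big_split /=.
  apply: eq_bigr => t _; rewrite -(det_measured _ _ _ dis).
  rewrite (outcome_stateE _ _ dis uU) outcome_probE.
  rewrite entangled_fractionE ?invr_ge0 ?fro_ge0 // unmat4K mulrA nuc_sq.
  (* An outcome of probability 0 has a vanishing slice, so both sides are 0; otherwise the
     probability cancels its inverse. *)
  have [h0|n0] := eqVneq (fro (measured_slice i j psi U t)) 0.
    by rewrite h0 (fro_eq0 h0) det0 cabs0 !mul0r addr0.
  by rewrite divff //; field.
apply: sup_attained.
  have [U uU [d1 d2]] := takagi (qform_sym i j psi); exists U => //.
  have uUT : U^T \is unitarymx by rewrite trmx_unitary.
  by rewrite val // sum2 -(nuc_diag d1 d2) (nuc_unitary _ uU uUT).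
move=> _ [U uU ->]; rewrite val // lerD2l sum2.
have uUT : U^T \is unitarymx by rewrite trmx_unitary.
by rewrite -(nuc_unitary _ uU uUT) diag_le_nuc.
Qed.

Lemma teleE i j k psi : distinct i j k -> unit_vector psi ->
  tele i j k psi = tangle i j psi.
Proof.
move=> dis /unit_vectorE psi1.
rewrite /tele /teleport_fidelity (assisted_fractionE dis psi1) tangle.unlock.
by field.
Qed.

End Teleportation.

(** * Biseparability and the two pure-state measures *)

Section Biseparability.
Variable R : realType.
Local Notation C := R[i].
Local Notation conj := (@Num.conj C).
Implicit Types psi : 'cV[C]_(2 * 2 * 2).

Definition mix (S : {set 'I_3}) (b b' : 'I_3 -> 'I_2) l :=
  if l \in S then b l else b' l.

(* Being a product across [S | ~: S] without mention of the two factors. *)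
Lemma product_across_exchange S psi b b' : product_across S psi ->
  psi (ket_index b) ord0 * psi (ket_index b') ord0 =
  psi (ket_index (mix S b b')) ord0 * psi (ket_index (mix S b' b)) ord0.
Proof.
case=> f [g fg].
have e c : psi (ket_index c) ord0 =
    f (restrict_bits S [ffun l => c l]) * g (restrict_bits (~: S) [ffun l => c l]).
  by rewrite -fg; congr (psi _ _); apply: ket_index_ext; rewrite ffunE.
rewrite !e.
have r1 c c' : restrict_bits S [ffun l => mix S c c' l] =
    restrict_bits S [ffun l => c l].
  by apply/ffunP=> -[l lS]; rewrite !ffunE /mix /= lS.
have r2 c c' : restrict_bits (~: S) [ffun l => mix S c c' l] =
    restrict_bits (~: S) [ffun l => c' l].
  apply/ffunP=> -[l lS]; rewrite !ffunE /mix /=.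
  by move: (lS); rewrite inE => /negbTE->.
by rewrite !r1 !r2; ring.
Qed.

(** Party i is alone on its side, so its bit can be exchanged between two amplitudes. For slices X
    and Y this gives X00 Y11 = X10 Y01 and Y00 X11 = Y10 X01, and the four terms of [pdet X Y]
    cancel in pairs. *)
Lemma product_across_qform0 i j k (S : {set 'I_3}) psi : distinct i j k ->
  (i \in S) = ~~ (j \in S) -> (k \in S) = (j \in S) ->
  product_across S psi -> qform i j psi = 0.
Proof.
move=> dis iS kS pS; apply/matrixP=> s t; rewrite !mxE.
have h s' t' : slice i j psi s' 0 0 * slice i j psi t' 1 1 =
    slice i j psi s' 1 0 * slice i j psi t' 0 1.
  rewrite !sliceE (product_across_exchange _ _ pS).
  case jS: (j \in S) iS kS => /= iS kS; last rewrite mulrC; congr (_ * _);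
    congr (psi _ _); apply: ket_index_ext; rewrite /mix /bits;
    move: i j k dis jS iS kS pS;
    by apply: distinct_ind => h1 h2 h3 _; rewrite ?h1 ?h2 ?h3.
move: (h s t) (h t s); rewrite /pdet.
move: (slice i j psi s) (slice i j psi t) => X Y h1 h2.
apply/eqP; rewrite mulf_eq0; apply/orP; left; apply/eqP.
ring: h1 h2.
Qed.

Lemma factor_biseparable i j k psi (u : 'I_2 -> C) (G : 'I_2 -> 'I_2 -> C) :
  distinct i j k ->
  (forall b, psi (ket_index b) ord0 = u (b i) * G (b j) (b k)) ->
  biseparable_pure psi.
Proof.
move=> dis H.
have iS : i \in [set i] by rewrite inE.
have jS : j \in ~: [set i].
  by rewrite !inE; case/and3P: dis; rewrite eq_sym.
have kS : k \in ~: [set i] by rewrite !inE; case/and3P: dis.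
exists [set i]; split.
- by apply/set0Pn; exists i.
- by apply/set0Pn; exists j.
exists (fun x => u (x (exist _ i iS))),
       (fun x => G (x (exist _ j jS)) (x (exist _ k kS))).
by move=> b; rewrite H !ffunE.
Qed.

Lemma rank1 (X : 'M[C]_2) : \det X = 0 ->
  exists p q : 'I_2 -> C, forall a b, X a b = p a * q b.
Proof.
rewrite det2 => dX.
have [->|X0] := eqVneq X 0.
  by exists (fun=> 0), (fun=> 0) => a b; rewrite mxE mul0r.
have [a0 [b0 n0]] : exists a b, X a b != 0.
  case: (pickP (fun ab => X ab.1 ab.2 != 0)) => [[a b] /= h|h].
    by exists a, b.
  case/eqP: X0; apply/matrixP=> a b; rewrite mxE.
  by have := h (a, b); move/negbFE/eqP.
exists (fun a => X a b0), (fun b => X a0 b / X a0 b0) => a b.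
apply: (mulIf n0); rewrite -mulrA divfK //.
have {}dX : X 0 0 * X 1 1 = X 0 1 * X 1 0 by apply/eqP; rewrite -subr_eq0 dX.
by move: a0 b0 a b n0; do 4![apply: ord2P] => _; first [ring | ring: dX].
Qed.

Lemma parallel (p r : 'I_2 -> C) a0 : p a0 != 0 -> p 0 * r 1 - p 1 * r 0 = 0 ->
  exists c, forall a, r a = c * p a.
Proof.
move=> n0 /eqP; rewrite subr_eq0 => /eqP h.
exists (r a0 / p a0) => a; apply: (mulIf n0); rewrite mulrAC divfK //.
by move: a0 a n0; do 2![apply: ord2P] => _; first [ring | ring: h].
Qed.

(** The diagonal of Q makes both slices of rank at most one, p q^T and r w^T. The off-diagonal entry
    is then half of (p0 r1 - p1 r0)(q0 w1 - q1 w0): either p and r are parallel and i splits off, or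
    q and w are and j splits off. *)
Lemma qform0_biseparable i j k psi : distinct i j k ->
  qform i j psi = 0 -> biseparable_pure psi.
Proof.
move=> dis Q0.
have q0 s t : pdet (slice i j psi s) (slice i j psi t) = 0.
  by have /matrixP/(_ s t) := Q0; rewrite !mxE.
have amp b : psi (ket_index b) ord0 = slice i j psi (b k) (b i) (b j).
  rewrite sliceE; congr (psi _ _); apply: ket_index_ext; rewrite /bits;
  by move: i j k dis {Q0 q0}; apply: distinct_ind.
have dis' : distinct j i k.
  by case/and3P: dis => *; apply/and3P; split; rewrite // eq_sym.
pose both (u : 'I_2 -> C) (G : 'I_2 -> 'I_2 -> C) :=
  (forall s a b, slice i j psi s a b = u a * G b s) \/
  (forall s a b, slice i j psi s a b = u b * G a s).
suff [u [G [H|H]]] : exists u G, both u G.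
- by apply: (factor_biseparable (u := u) (G := G) dis) => b; rewrite amp H.
- by apply: (factor_biseparable (u := u) (G := G) dis') => b; rewrite amp H.
have [p [q pq]] := rank1 (etrans (esym (pdet_det _)) (q0 0 0)).
have [r [w rw]] := rank1 (etrans (esym (pdet_det _)) (q0 1 1)).
(* If [p] or [q] is zero, slice 0 vanishes and the factors of slice 1 alone do. *)
have [/existsP[a0 pa0]|] := boolP [exists a, p a != 0]; last first.
  move/existsPn => p0; exists r, (fun b s => if s == 0 then 0 else w b).
  left; apply: ord2P => a b /=; rewrite (pq, rw) //.
  by have /negbNE/eqP-> := p0 a; rewrite mul0r mulr0.
have [/existsP[b0 qb0]|] := boolP [exists b, q b != 0]; last first.
  move/existsPn => p0; exists r, (fun b s => if s == 0 then 0 else w b).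
  left; apply: ord2P => a b /=; rewrite (pq, rw) //.
  by have /negbNE/eqP-> := p0 b; rewrite !mulr0.
have /eqP : (p 0 * r 1 - p 1 * r 0) * (q 0 * w 1 - q 1 * w 0) = 0.
  transitivity (2 * pdet (slice i j psi 0) (slice i j psi 1)).
    by rewrite /pdet !pq !rw; field.
  by rewrite q0 mulr0.
rewrite mulf_eq0 => /orP[/eqP h|/eqP h].
  have [c hc] := parallel pa0 h.
  exists p, (fun b s => if s == 0 then q b else c * w b).
  left; apply: ord2P => a b /=; rewrite (pq, rw) // hc; ring.
have [c hc] := parallel qb0 h.
exists q, (fun a s => if s == 0 then p a else c * r a).
right; apply: ord2P => a b /=; rewrite (pq, rw) ?hc; ring.
Qed.

Lemma tangle_eq0 i j psi : tangle i j psi = 0 <-> qform i j psi = 0.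
Proof.
rewrite tangle.unlock; split=> [/eqP|->]; last by rewrite nuc0 mulr0.
by rewrite mulf_eq0 pnatr_eq0 /= => /eqP/nuc_eq0.
Qed.

Definition tangle_prod psi := tangle partyA partyB psi *
  tangle partyB partyC psi * tangle partyC partyA psi.

Lemma tangle_prod_ge0 psi : 0 <= tangle_prod psi.
Proof.
by apply: mulr_ge0; [apply: mulr_ge0|]; exact: tangle_ge0.
Qed.

(** One side of a bipartition of three parties is a single party, and each party comes first in
    exactly one of the cyclic pairs AB, BC, CA; the tangle of that pair vanishes. *)
Lemma tangle_prod_eq0 psi : tangle_prod psi = 0 <-> biseparable_pure psi.
Proof.
rewrite /tangle_prod; split=> [/eqP|].
  rewrite 2!mulf_eq0 => /orP[/orP[]|] /eqP/tangle_eq0.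
  - by move=> h; apply: (qform0_biseparable (k := partyC) _ h).
  - by move=> h; apply: (qform0_biseparable (k := partyA) _ h).
  - by move=> h; apply: (qform0_biseparable (k := partyB) _ h).
case=> S [S0 SC0 pS]; apply/eqP; rewrite 2!mulf_eq0.
have h i j k : distinct i j k -> (i \in S) = ~~ (j \in S) ->
    (k \in S) = (j \in S) -> tangle i j psi == 0.
  by move=> dis iS kS; apply/eqP/tangle_eq0/(product_across_qform0 dis iS kS).
have hA := h partyA partyB partyC isT; have hB := h partyB partyC partyA isT.
have hC := h partyC partyA partyB isT.
case SA: (partyA \in S) hA hB hC; case SB: (partyB \in S);
  case SC: (partyC \in S) => hA hB hC.
- case/set0Pn: SC0 => l; rewrite inE.
  by move: l; apply: party_ind; rewrite ?SA ?SB ?SC.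
- by rewrite hC // !orbT.
- by rewrite hB // !orbT.
- by rewrite hA.
- by rewrite hA.
- by rewrite hB // !orbT.
- by rewrite hC // !orbT.
- case/set0Pn: S0 => l.
  by move: l; apply: party_ind; rewrite ?SA ?SB ?SC.
Qed.

Definition tangle_min psi : R := Num.min (tangle partyA partyB psi)
  (Num.min (tangle partyB partyC psi) (tangle partyC partyA psi)).

Definition tangle_gm psi : R := tangle_prod psi `^ (3^-1).

Lemma Tmin_pureE psi : unit_vector psi -> Tmin_pure psi = tangle_min psi.
Proof. by move=> u; rewrite /Tmin_pure !teleE. Qed.

Lemma TGM_pureE psi : unit_vector psi -> TGM_pure psi = tangle_gm psi.
Proof. by move=> u; rewrite /TGM_pure !teleE. Qed.

Lemma tangle_min_ge0 psi : 0 <= tangle_min psi.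
Proof. by rewrite !le_min !tangle_ge0. Qed.

Lemma tangle_gm_ge0 psi : 0 <= tangle_gm psi. Proof. exact: powR_ge0. Qed.

Lemma tangle_minZ z psi : tangle_min (z *: psi) = sq z * tangle_min psi.
Proof. by rewrite /tangle_min !tangleZ -!minr_pMr ?sq_ge0. Qed.

Lemma cbrtX (x : R) : 0 <= x -> (x `^ 3^-1) ^+ 3 = x.
Proof.
move=> x0; rewrite -powR_mulrn ?powR_ge0 // -powRrM mulVf ?powRr1 //.
by rewrite pnatr_eq0.
Qed.

Lemma Xcbrt (x : R) : 0 <= x -> (x ^+ 3) `^ 3^-1 = x.
Proof.
move=> x0; rewrite -powR_mulrn // -powRrM mulfV ?powRr1 //.
by rewrite pnatr_eq0.
Qed.

Lemma tangle_gmZ z psi : tangle_gm (z *: psi) = sq z * tangle_gm psi.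
Proof.
rewrite /tangle_gm /tangle_prod !tangleZ -[in RHS](Xcbrt (sq_ge0 z)) -powRM.
- by congr (_ `^ _); ring.
- by rewrite exprn_ge0 ?sq_ge0.
- exact: tangle_prod_ge0.
Qed.

Lemma tangle_min_kraus l n (M : 'I_n -> 'M[C]_2) psi : kraus M ->
  \sum_s tangle_min (at_party l (M s) *m psi) <= tangle_min psi.
Proof.
move=> kM.
have h i j k : distinct i j k ->
    (forall phi, tangle_min phi <= tangle i j phi) ->
    \sum_s tangle_min (at_party l (M s) *m psi) <= tangle i j psi.
  by move=> dis le; apply: le_trans (tangle_kraus l psi dis kM); exact: ler_sum.
rewrite [leRHS]/tangle_min !le_min.
apply/and3P; split; [apply: (h _ _ partyC)|apply: (h _ _ partyA)|
  apply: (h _ _ partyB)] => // phi; by rewrite /tangle_min !ge_min lexx ?orbT.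
Qed.

Lemma holder3 n (a b c : 'I_n -> R) (A B D : R) :
  (forall s, 0 <= a s) -> (forall s, 0 <= b s) -> (forall s, 0 <= c s) ->
  \sum_s a s <= A -> \sum_s b s <= B -> \sum_s c s <= D ->
  \sum_s (a s * b s * c s) `^ 3^-1 <= (A * B * D) `^ 3^-1.
Proof.
move=> a0 b0 c0 aA bB cD.
have A0 : 0 <= A by apply: le_trans aA; apply: sumr_ge0.
have B0 : 0 <= B by apply: le_trans bB; apply: sumr_ge0.
have D0 : 0 <= D by apply: le_trans cD; apply: sumr_ge0.
(* If one of the bounds is 0 then so is every term; this settles the case in which the bounds cannot
   be divided by. *)
have triv : (forall s, a s * b s * c s = 0) ->
    \sum_s (a s * b s * c s) `^ 3^-1 <= (A * B * D) `^ 3^-1.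
  move=> h; rewrite big1 ?powR_ge0 // => s _.
  by rewrite h powR0 // invr_eq0 pnatr_eq0.
have z (f : 'I_n -> R) : (forall s, 0 <= f s) -> \sum_s f s <= 0 ->
    forall s, f s = 0.
  move=> f0 fs s; apply/eqP; rewrite eq_le f0 andbT (le_trans _ fs) //.
  by rewrite (bigD1 s) //= lerDl sumr_ge0.
have [A1|A1] := eqVneq A 0.
  by apply: triv => s; rewrite (z a) ?mulr0 ?mul0r // -[leRHS]A1.
have [B1|B1] := eqVneq B 0.
  by apply: triv => s; rewrite (z b) ?mulr0 ?mul0r // -[leRHS]B1.
have [D1|D1] := eqVneq D 0.
  by apply: triv => s; rewrite (z c) ?mulr0 ?mul0r // -[leRHS]D1.
have {}A1 : 0 < A by rewrite lt_def A1.
have {}B1 : 0 < B by rewrite lt_def B1.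
have {}D1 : 0 < D by rewrite lt_def D1.
have amgm (x y w : R) : 0 <= x -> 0 <= y -> 0 <= w ->
    (x * y * w) `^ 3^-1 <= (x + y + w) / 3.
  move=> x0 y0 w0; rewrite !powRM ?mulr_ge0 //.
  rewrite -{2}(cbrtX x0) -{2}(cbrtX y0) -{2}(cbrtX w0).
  move: (powR_ge0 x 3^-1) (powR_ge0 y 3^-1) (powR_ge0 w 3^-1).
  move: (_ `^ _) (_ `^ _) (_ `^ _) => {x0 y0 w0}x {}y {}w x0 y0 w0.
  rewrite ler_pdivlMr //.
  (* This product is twice x^3 + y^3 + w^3 - 3 x y w. *)
  have : 0 <= (x + y + w) * ((x - y) ^+ 2 + (y - w) ^+ 2 + (w - x) ^+ 2).
    by rewrite mulr_ge0 ?addr_ge0 ?sqr_ge0.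
  by nra.
(* AM-GM for the normalised terms a/A, b/B, c/D. *)
apply: (@le_trans _ _ (\sum_s (A * B * D) `^ 3^-1 *
    ((a s / A + b s / B + c s / D) / 3))).
  apply: ler_sum => s _.
  have -> : a s * b s * c s =
      (A * B * D) * ((a s / A) * (b s / B) * (c s / D)).
    by field; rewrite !lt0r_neq0.
  rewrite powRM ?mulr_ge0 ?invr_ge0 //.
  by rewrite ler_wpM2l ?powR_ge0 // amgm // mulr_ge0 ?invr_ge0.
rewrite -mulr_sumr -mulr_suml !big_split /= -!mulr_suml.
rewrite -[leRHS]mulr1; apply: ler_wpM2l; first exact: powR_ge0.
rewrite ler_pdivrMr // mul1r.
have h (x y : R) : 0 < y -> x <= y -> x / y <= 1.
  by move=> y0 xy; rewrite ler_pdivrMr // mul1r.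
by have := h _ _ A1 aA; have := h _ _ B1 bB; have := h _ _ D1 cD; lra.
Qed.

Lemma tangle_gm_kraus l n (M : 'I_n -> 'M[C]_2) psi : kraus M ->
  \sum_s tangle_gm (at_party l (M s) *m psi) <= tangle_gm psi.
Proof.
move=> kM; apply: holder3 => *; rewrite ?tangle_ge0 //.
- exact: (@tangle_kraus _ partyA partyB partyC _ _ _ _ isT).
- exact: (@tangle_kraus _ partyB partyC partyA _ _ _ _ isT).
- exact: (@tangle_kraus _ partyC partyA partyB _ _ _ _ isT).
Qed.

Lemma tangle_min_eq0 psi : tangle_min psi = 0 <-> biseparable_pure psi.
Proof.
rewrite -tangle_prod_eq0 /tangle_min /tangle_prod.
have := tangle_ge0 partyA partyB psi; have := tangle_ge0 partyB partyC psi.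
have := tangle_ge0 partyC partyA psi.
move: (tangle _ _ _) (tangle _ _ _) (tangle _ _ _) => x y z z0 y0 x0.
split=> [|/eqP].
  by rewrite !minEle; do 2?case: ifP => _; move=> ->; rewrite ?(mul0r, mulr0).
rewrite !mulf_eq0 => h; apply/eqP; rewrite eq_le !le_min x0 y0 z0 andbT !ge_min.
by case/orP: h => [/orP[]|] /eqP->; rewrite lexx ?orbT.
Qed.

Lemma tangle_gm_eq0 psi : tangle_gm psi = 0 <-> biseparable_pure psi.
Proof.
rewrite -tangle_prod_eq0 /tangle_gm; split=> [h|->].
  by rewrite -(cbrtX (tangle_prod_ge0 psi)) h expr0n.
by rewrite powR0 // invr_eq0 pnatr_eq0.
Qed.

(** x^3 <= x on [0, 1], applied to the cube root of the product. *)
Lemma tangle_prod_le_gm psi : tangle_gm psi <= 1 ->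
  tangle_prod psi <= tangle_gm psi.
Proof.
move=> h; rewrite -[leLHS](cbrtX (tangle_prod_ge0 psi)) -/(tangle_gm psi).
by rewrite ler_iXnr // tangle_gm_ge0.
Qed.

End Biseparability.

(** * Ensembles, LOCC and convex roofs *)

Section Ensembles.
Variable R : realType.
Local Notation C := R[i].
Local Notation conj := (@Num.conj C).

(* Ensembles are lists of unnormalised vectors, the squared norm of a vector
   being its weight. *)
Definition ensemble n (s : seq 'cV[C]_n) : 'M[C]_n :=
  \sum_(v <- s) projector v.

Lemma ensemble_cat n (s1 s2 : seq 'cV[C]_n) :
  ensemble (s1 ++ s2) = ensemble s1 + ensemble s2.
Proof. exact: big_cat. Qed.

Lemma ensemble_map m n (K : 'M[C]_(m, n)) s :
  ensemble [seq K *m v | v <- s] = K *m ensemble s *m adj K.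
Proof.
rewrite /ensemble big_map mulmx_sumr mulmx_suml.
by apply: eq_bigr => v _; rewrite projector_mul.
Qed.

Lemma ensemble_scale n (x : R) (s : seq 'cV[C]_n) : 0 <= x ->
  ensemble [seq (Num.sqrt x)%:C *: v | v <- s] = x%:C *: ensemble s.
Proof.
move=> x0; rewrite /ensemble big_map scaler_sumr; apply: eq_bigr => v _.
by rewrite projectorZ -cabs2 cabs_real ?sqrtr_ge0 // sqr_sqrtr.
Qed.

Lemma tr_projector n (v : 'cV[C]_n) : \tr (projector v) = (fro v)%:C.
Proof. by rewrite froE. Qed.

Lemma tr_ensemble n (s : seq 'cV[C]_n) :
  \tr (ensemble s) = (\sum_(v <- s) fro v)%:C.
Proof.
rewrite /ensemble raddf_sum rmorph_sum /=.
by apply: eq_bigr => v _; exact: tr_projector.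
Qed.

Lemma ensemble_tr0 n (s : seq 'cV[C]_n) :
  complex.Re (\tr (ensemble s)) = 0 -> ensemble s = 0.
Proof.
rewrite tr_ensemble /= => /eqP; rewrite psumr_eq0 => [/allP h|v _]; last first.
  exact: fro_ge0.
rewrite /ensemble big_seq big1 // => v /h /eqP/fro_eq0->.
by rewrite /projector mul0mx.
Qed.

Lemma adj_projector n (v : 'cV[C]_n) : adj (projector v) = projector v.
Proof. by rewrite /projector adjmxM adjmxK. Qed.

Lemma density_ensemble n (s : seq 'cV[C]_n) :
  \tr (ensemble s) = 1 -> density (ensemble s).
Proof.
move=> t1; split=> // [|v].
  rewrite /ensemble adjmx_sum; apply: eq_bigr => v _; exact: adj_projector.
rewrite /ensemble mulmx_sumr mulmx_suml summxE; apply: sumr_ge0 => u _.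
rewrite /projector mulmxA -[_ *m _ *m v]mulmxA mxE big_ord1.
by rewrite -[adj u *m v]adjmxK adjmxM adjmxK (adjE (adj v *m u)) -sqE ler0c sq_ge0.
Qed.

Lemma ensemble_of_density n (rho : 'M[C]_n) : density rho ->
  exists s, rho = ensemble s.
Proof.
case=> herm psd _.
have /orthomx_spectralP : rho \is normalmx.
  by apply/normalmxP; rewrite -/(adj rho) herm.
set P := spectralmx rho; set d := spectral_diag rho.
have uP : P \is unitarymx by exact: spectral_unitarymx.
rewrite invmx_unitary // -/(adj P) => e.
have d0 k : 0 <= d 0 k.
  have := psd (col k (adj P)).
  have -> : adj (col k (adj P)) = row k P.
    by apply/matrixP=> x y; rewrite !mxE conjCK.
  have -> : (row k P *m rho *m col k (adj P)) ord0 ord0 = d 0 k.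
    have -> : (row k P *m rho *m col k (adj P)) ord0 ord0 = (P *m rho *m adj P) k k.
      by rewrite colE mulmxA -!row_mul -colE !mxE.
    rewrite e !mulmxA unitary_mulV // mul1mx -mulmxA unitary_mulV // mulmx1.
    by rewrite mxE eqxx.
  by [].
exists [seq sqrtC (d 0 k) *: col k (adj P) | k <- enum 'I_n].
rewrite /ensemble big_map big_enum /= e.
apply/matrixP=> x y; rewrite summxE mxE; apply: eq_bigr => k _.
rewrite projectorE mul_mx_diag !mxE rmorphM /= conjCK.
rewrite [X in _ * (X * _)]conj_Creal ?ger0_real ?sqrtC_ge0 //.
by rewrite -[in LHS](sqrtCK (d 0 k)); ring.
Qed.

End Ensembles.

(** * Protocols acting on unnormalised ensembles *)

Section Locc.
Variable R : realType.
Local Notation C := R[i].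
Implicit Types rho : 'M[C]_(2 * 2 * 2).

Lemma meas_prob_scale k M (c : R) rho :
  meas_prob k M (c%:C *: rho) = c * meas_prob k M rho.
Proof.
rewrite /meas_prob -scalemxAr -scalemxAl mxtraceZ.
by case: (\tr _) => a b /=; rewrite mul0r subr0.
Qed.

Lemma locc_weighted0 m (P : locc R m) l : locc_weighted P 0 l = 0.
Proof.
elim: P => [l'|k n M next IH] /=; first by rewrite scaler0.
by rewrite big1 // => t _; rewrite /meas_state mulmx0 mul0mx scaler0 IH scaler0.
Qed.

(** For nonzero [c], [meas_state] does not see the scaling, and the first [meas_prob] carries it out
    linearly. *)
Lemma locc_weighted_scale m (P : locc R m) (c : R) rho l :
  locc_weighted P (c%:C *: rho) l = c%:C *: locc_weighted P rho l.
Proof.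
have [->|c0] := eqVneq c 0; first by rewrite !scale0r locc_weighted0.
elim: P => [l'|k n M next IH] /=; first by rewrite !scalerA mulrC.
rewrite scaler_sumr; apply: eq_bigr => t _.
rewrite scalerA -rmorphM meas_prob_scale; congr (_ *: locc_weighted _ _ _).
rewrite /meas_state meas_prob_scale -scalemxAr -scalemxAl scalerA -rmorphM.
by rewrite invfM mulrC mulVKf.
Qed.

(** The normalisation in [meas_state] cancels against the weight [meas_prob]. When that weight is 0,
    the unnormalised state is positive with trace 0, hence zero. *)
Lemma locc_weighted_round m k n (M : 'I_n -> 'M[C]_2) (next : 'I_n -> locc R m)
    s l :
  locc_weighted (Round k M next) (ensemble s) l =
  \sum_t locc_weighted (next t)
    (ensemble [seq at_party k (M t) *m v | v <- s]) l.
Proof.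
rewrite /=; apply: eq_bigr => t _; rewrite /meas_state ensemble_map.
rewrite locc_weighted_scale scalerA -rmorphM.
have [h0|n0] := eqVneq (meas_prob k (M t) (ensemble s)) 0; last first.
  by rewrite mulfV // scale1r.
move: (h0); rewrite /meas_prob -ensemble_map => /ensemble_tr0->.
by rewrite locc_weighted0 scaler0.
Qed.

Lemma locc_probE m (P : locc R m) s l : \tr (ensemble s) = 1 ->
  locc_prob P (ensemble s) l =
  complex.Re (\tr (locc_weighted P (ensemble s) l)).
Proof.
elim: P s => [l'|k n M next IH] s t1 /=.
  by rewrite mxtraceZ t1 mulr1; case: (_ == _).
have trD (F : 'I_n -> 'M[C]_(2 * 2 * 2)) : \tr (\sum_t F t) = \sum_t \tr (F t).
  exact: raddf_sum.
have ReD (F : 'I_n -> C) :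
    complex.Re (\sum_t F t) = \sum_t complex.Re (F t).
  by elim/big_rec2: _ => // i y1 [a b] _ /= ->; case: (F i).
rewrite trD ReD; apply: eq_bigr => t _; rewrite mxtraceZ.
have ReM (x : R) (z : C) : complex.Re (x%:C * z) = x * complex.Re z.
  by case: z => a b /=; rewrite mul0r subr0.
rewrite ReM; have [->|n0] := eqVneq (meas_prob k (M t) (ensemble s)) 0.
  by rewrite !mul0r.
have p0 : 0 <= meas_prob k (M t) (ensemble s).
  rewrite /meas_prob -ensemble_map tr_ensemble /=; apply: sumr_ge0 => v _.
  exact: fro_ge0.
congr (_ * _); rewrite /meas_state -ensemble_map -ensemble_scale ?invr_ge0 //.
apply: IH; rewrite ensemble_scale ?invr_ge0 // mxtraceZ /meas_prob -ensemble_map.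
move: n0; rewrite /meas_prob -ensemble_map tr_ensemble /= => n0.
by rewrite -rmorphM mulVf.
Qed.

Lemma local_op_mul (M N : 'I_3 -> 'M[C]_2) :
  local_op M *m local_op N = local_op (fun l => M l *m N l).
Proof. by rewrite /local_op !tensmx_mul. Qed.

Lemma local_op_ext (M N : 'I_3 -> 'M[C]_2) :
  (forall l, M l = N l) -> local_op M = local_op N.
Proof. by move=> h; rewrite /local_op !h. Qed.

Lemma local_opE (M : 'I_3 -> 'M[C]_2) :
  local_op M = at_party partyA (M partyA) *m
    (at_party partyB (M partyB) *m at_party partyC (M partyC)).
Proof.
rewrite /at_party !local_op_mul; apply: local_op_ext.
by apply: party_ind => /=; rewrite ?mul1mx ?mulmx1.
Qed.

Lemma local_op1 : local_op (fun=> 1%:M) = 1%:M :> 'M[C]_(2 * 2 * 2).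
Proof.
rewrite /local_op; apply/matrixP=> x y.
case: (mxtens_indexP x) => a b; case: (mxtens_indexP y) => a' b'.
case: (mxtens_indexP a) => a1 a2; case: (mxtens_indexP a') => a1' a2'.
rewrite !tensmxE !mxE !(inj_eq (can_inj (@mxtens_indexK _ _))) !xpair_eqE /=.
by rewrite !(inj_eq (can_inj (@mxtens_indexK _ _))) !xpair_eqE -!natrM !mulnb.
Qed.

Lemma adj_local_op (M : 'I_3 -> 'M[C]_2) :
  adj (local_op M) = local_op (fun l => adj (M l)).
Proof. by rewrite /local_op /adj !trmx_tens !map_mxT. Qed.

End Locc.

(** * Convex roofs of homogeneous functions that contract under local measurements *)

Section Roof.
Variable R : realType.
Local Notation C := R[i].
Variables Ep E : 'cV[C]_(2 * 2 * 2) -> R.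
Hypothesis EpE : forall psi, unit_vector psi -> Ep psi = E psi.
Hypothesis E_ge0 : forall psi, 0 <= E psi.
Hypothesis EZ : forall z psi, E (z *: psi) = sq z * E psi.
Hypothesis E_kraus : forall l n (M : 'I_n -> 'M[C]_2) psi, kraus M ->
  \sum_s E (at_party l (M s) *m psi) <= E psi.
Implicit Types (rho : 'M[C]_(2 * 2 * 2)) (s : seq 'cV[C]_(2 * 2 * 2)).

(** By homogeneity, [E v] is the weight of [v] times the value at its normalisation, so this is the
    average over the decomposition that [s] encodes. *)
Definition cost s : R := \sum_(v <- s) E v.

Lemma cost_ge0 s : 0 <= cost s. Proof. exact: sumr_ge0. Qed.

Lemma cost_scale (x : R) s : 0 <= x ->
  cost [seq (Num.sqrt x)%:C *: v | v <- s] = x * cost s.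
Proof.
move=> x0; rewrite /cost big_map mulr_sumr; apply: eq_bigr => v _.
by rewrite EZ -cabs2 cabs_real ?sqrtr_ge0 // sqr_sqrtr.
Qed.

Lemma cost_cat s1 s2 : cost (s1 ++ s2) = cost s1 + cost s2.
Proof. exact: big_cat. Qed.

Lemma pure_decomposition_cost_ge0 m rho (p : 'I_m -> R) psi :
  pure_decomposition rho p psi -> 0 <= \sum_l p l * Ep (psi l).
Proof.
case=> p0 _ u _; apply: sumr_ge0 => l _; rewrite EpE //.
by rewrite mulr_ge0.
Qed.

Lemma convex_roof_le_decomposition m rho (p : 'I_m -> R) psi :
  pure_decomposition rho p psi ->
  convex_roof Ep rho <= \sum_l p l * Ep (psi l).
Proof.
move=> dec; apply: ge_inf; last by exists m, p, psi.
exists 0 => _ [m' [p' [psi' [dec' ->]]]].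
exact: pure_decomposition_cost_ge0 dec'.
Qed.

(** Zero vectors are dropped because they cannot be normalised. The last clause lets properties
    invariant under scaling, such as biseparability, pass from [s] to the decomposition. *)
Lemma ensemble_decomposition s : \tr (ensemble s) = 1 ->
  exists m (p : 'I_m -> R) (psi : 'I_m -> 'cV[C]_(2 * 2 * 2)),
  [/\ pure_decomposition (ensemble s) p psi,
      cost s = \sum_l p l * E (psi l)
    & forall l, exists z v, [/\ v \in s & psi l = z *: v]].
Proof.
move=> tr1; pose s' : seq 'cV[C]_(2 * 2 * 2) := [seq v <- s | v != 0].
pose p (i : 'I_(size s')) := fro (nth 0 s' i).
pose psi (i : 'I_(size s')) : 'cV[C]_(2 * 2 * 2) :=
  ((Num.sqrt (p i))^-1)%:C *: nth 0 s' i.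
have p_gt0 i : 0 < p i.
  rewrite lt_def fro_ge0 andbT.
  have : nth 0 s' i \in s' by exact: mem_nth.
  by rewrite mem_filter => /andP[+ _]; apply: contraNneq => /fro_eq0->.
have sum_s (V : nmodType) (F : 'cV[C]_(2 * 2 * 2) -> V) : F 0 = 0 ->
    \sum_(v <- s) F v = \sum_(i < size s') F (nth 0 s' i).
  move=> F0; rewrite -(big_mkord xpredT (fun i => F (nth 0 s' i))).
  rewrite -(big_nth 0 xpredT F) big_filter [RHS]big_mkcond /=.
  by apply: eq_bigr => v _; case: eqVneq => [->|].
have nthE (i : 'I_(size s')) : nth 0 s' i = (Num.sqrt (p i))%:C *: psi i.
  by rewrite /psi scalerA -rmorphM mulfV ?scale1r // sqrtr_eq0 -ltNge.
have sqp i : sq (Num.sqrt (p i))%:C = p i.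
  by rewrite -cabs2 cabs_real ?sqrtr_ge0 // sqr_sqrtr // ltW.
exists (size s'), p, psi; split.
- split=> [i||i|]; first exact: ltW.
  + apply: complexI; rewrite -[RHS]tr1 tr_ensemble sum_s //.
    by rewrite /fro big1 // => i _; rewrite big1 // => j _; rewrite mxE sq0.
  + apply/unit_vectorE; rewrite froZ -/(p i) -cabs2.
    rewrite cabs_real ?invr_ge0 ?sqrtr_ge0 // exprVn sqr_sqrtr ?ltW //.
    by rewrite mulVf // gt_eqF.
  + rewrite /ensemble sum_s; last by rewrite /projector mul0mx.
    by apply: eq_bigr => i _; rewrite nthE projectorZ sqp.
- rewrite /cost sum_s; last by rewrite -(scale0r 0) EZ sq0 mul0r.
  by apply: eq_bigr => i _; rewrite nthE EZ sqp.
move=> i; exists ((Num.sqrt (p i))^-1)%:C, (nth 0 s' i); split=> //.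
by have := mem_nth 0 (ltn_ord i); rewrite mem_filter => /andP[].
Qed.

Lemma convex_roof_le s : \tr (ensemble s) = 1 ->
  convex_roof Ep (ensemble s) <= cost s.
Proof.
move=> /ensemble_decomposition[m [p [psi [dec -> _]]]].
apply: le_trans (convex_roof_le_decomposition dec) _.
by case: dec => _ _ u _; apply: ler_sum => l _; rewrite EpE.
Qed.

Lemma convex_roof_near rho e : density rho -> 0 < e ->
  exists2 s, rho = ensemble s & cost s < convex_roof Ep rho + e.
Proof.
move=> drho e0; pose S : set R := [set x | exists m (p : 'I_m -> R)
  (psi : 'I_m -> 'cV[C]_(2 * 2 * 2)),
  pure_decomposition rho p psi /\ x = \sum_l p l * Ep (psi l)]%classic.
have hS : has_inf S.
  split; last first.
    exists 0 => _ [m [p [psi [dec ->]]]]; exact: pure_decomposition_cost_ge0 dec.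
  have [s es] := ensemble_of_density drho.
  have tr1 : \tr (ensemble s) = 1 by case: drho; rewrite es.
  have [m [p [psi [dec _ _]]]] := ensemble_decomposition tr1.
  exists (\sum_l p l * Ep (psi l)), m, p, psi; split=> //.
  by rewrite es.
have [_ [m [p [psi [[p0 _ u er] ->]]]] lt] := inf_adherent e0 hS.
exists [seq (Num.sqrt (p l))%:C *: psi l | l <- enum 'I_m].
  rewrite er /ensemble big_map big_enum /=; apply: eq_bigr => l _.
  by rewrite projectorZ -cabs2 cabs_real ?sqrtr_ge0 // sqr_sqrtr.
apply: le_lt_trans lt; rewrite /cost big_map big_enum /=; apply: ler_sum => l _.
by rewrite EZ -cabs2 cabs_real ?sqrtr_ge0 // sqr_sqrtr // EpE.
Qed.

Lemma convex_roof_convex : convex_on_states (convex_roof Ep).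
Proof.
move=> rho sigma x drho dsigma /andP[x0 x1]; apply/ler_addgt0Pr => e e0.
have [s1 e1 lt1] := convex_roof_near drho e0.
have [s2 e2 lt2] := convex_roof_near dsigma e0.
have y0 : 0 <= 1 - x by rewrite subr_ge0.
pose s := [seq (Num.sqrt x)%:C *: v | v <- s1] ++
          [seq (Num.sqrt (1 - x))%:C *: v | v <- s2].
have es : ensemble s = x%:C *: rho + (1 - x)%:C *: sigma.
  by rewrite ensemble_cat !ensemble_scale // -e1 -e2.
rewrite -es; apply: le_trans (convex_roof_le _) _.
  rewrite es mxtraceD !mxtraceZ; case: drho => _ _ ->; case: dsigma => _ _ ->.
  by rewrite !mulr1 -rmorphD addrC subrK.
rewrite cost_cat !cost_scale //.
have := ler_wpM2l x0 (ltW lt1); have := ler_wpM2l y0 (ltW lt2).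
by rewrite !mulrDr; lra.
Qed.

(** A unitary is a measurement with a single outcome; the three parties apply theirs one after
    another. *)
Lemma cost_local_op_le (U : 'I_3 -> 'M[C]_2) s :
  (forall k, U k \is unitarymx) ->
  cost [seq local_op U *m v | v <- s] <= cost s.
Proof.
move=> uU; rewrite /cost big_map; apply: ler_sum => v _.
have step k w : E (at_party k (U k) *m w) <= E w.
  have := @E_kraus k 1 (fun=> U k) w; rewrite big_ord1; apply.
  by rewrite /kraus big_ord1 unitary_Vmul.
by rewrite local_opE -!mulmxA; do 3![apply: le_trans (step _ _) _].
Qed.

(** The inequality in one direction, applied also to the adjoint unitaries, gives equality. *)
Lemma convex_roof_local_unitary : local_unitary_invariant (convex_roof Ep).
Proof.
have le rho U : density rho -> (forall k, U k \is unitarymx) ->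
    density (local_op U *m rho *m adj (local_op U)) /\
    convex_roof Ep (local_op U *m rho *m adj (local_op U)) <= convex_roof Ep rho.
  move=> drho uU.
  have UU : adj (local_op U) *m local_op U = 1%:M.
    rewrite adj_local_op local_op_mul -local_op1; apply: local_op_ext => k.
    exact: unitary_Vmul.
  have tr1 : \tr (local_op U *m rho *m adj (local_op U)) = 1.
    by rewrite mxtrace_mulC mulmxA UU mul1mx; case: drho.
  split.
    have [s es] := ensemble_of_density drho; move: tr1.
    by rewrite es -ensemble_map; exact: density_ensemble.
  apply/ler_addgt0Pr => e e0; have [s es lt] := convex_roof_near drho e0.
  move: tr1; rewrite {1 2}es -ensemble_map => tr1.
  apply: le_trans (convex_roof_le tr1) _.
  exact: le_trans (cost_local_op_le s uU) (ltW lt).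
move=> rho U drho uU; apply/eqP; rewrite eq_le.
have [d1 ->] := le rho U drho uU.
have [_] := le _ (fun k => adj (U k)) d1 (fun k => adj_unitary (uU k)).
rewrite -adj_local_op adjmxK !mulmxA.
have UU : adj (local_op U) *m local_op U = 1%:M.
  rewrite adj_local_op local_op_mul -local_op1; apply: local_op_ext => k.
  exact: unitary_Vmul.
by rewrite UU mul1mx -mulmxA UU mulmx1.
Qed.

(** Every vector is followed down the tree, and [w l] collects what arrives at the leaves labelled
    l: averaging branches with the same label is concatenation. At each node [E_kraus] bounds the
    total cost vector by vector. *)
Lemma locc_cost m (P : locc R m) s : locc_valid P ->
  exists2 w : 'I_m -> seq 'cV[C]_(2 * 2 * 2),
    forall l, locc_weighted P (ensemble s) l = ensemble (w l)
  & \sum_l cost (w l) <= cost s.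
Proof.
elim: P s => [l'|k n M next IH] s /=.
  move=> _; exists (fun l => if l' == l then s else [::]) => [l|].
    case: ifP => _; first by rewrite scale1r.
    by rewrite scale0r /ensemble big_nil.
  rewrite (bigD1 l') //= eqxx big1 ?addr0 // => l; rewrite eq_sym => /negbTE->.
  by rewrite /cost big_nil.
move=> [kM vnext].
have /fin_all_exists[w hw] t : exists w : 'I_m -> seq 'cV[C]_(2 * 2 * 2),
    (forall l, locc_weighted (next t)
      (ensemble [seq at_party k (M t) *m v | v <- s]) l = ensemble (w l)) /\
    \sum_l cost (w l) <= cost [seq at_party k (M t) *m v | v <- s].
  have [w h1 h2] := IH t [seq at_party k (M t) *m v | v <- s] (vnext t).
  by exists w.
exists (fun l => flatten [seq w t l | t <- enum 'I_n]) => [l|].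
  rewrite -/(locc_weighted (Round k M next) _ _) locc_weighted_round.
  rewrite /ensemble big_flatten big_map big_enum /=; apply: eq_bigr => t _.
  by rewrite (hw t).1.
rewrite /cost (eq_bigr (fun l => \sum_t cost (w t l))); last first.
  by move=> l _; rewrite big_flatten big_map big_enum.
rewrite exchange_big /=.
apply: le_trans (ler_sum _ (fun t _ => (hw t).2)) _.
rewrite (eq_bigr (fun t => \sum_(v <- s) E (at_party k (M t) *m v))).
  by rewrite exchange_big /=; apply: ler_sum => v _; exact: E_kraus.
by move=> t _; rewrite /cost big_map.
Qed.

Lemma convex_roof_locc : locc_monotone (convex_roof Ep).
Proof.
move=> rho m P drho vP; apply/ler_addgt0Pr => e e0.
have [s es lt] := convex_roof_near drho e0.
have tr1 : \tr (ensemble s) = 1 by rewrite -es; case: drho.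
have [w hw le] := locc_cost s vP.
apply: le_trans (le_trans le (ltW lt)); apply: ler_sum => l _.
rewrite es /locc_state locc_probE // hw tr_ensemble /=.
set q := \sum_(v <- _) _.
(* For a label of probability 0, [locc_state] is not a state; the factor [q] removes it. *)
have [->|q0] := eqVneq q 0; first by rewrite mul0r cost_ge0.
have q_gt0 : 0 < q.
  by rewrite lt_def q0; apply: sumr_ge0 => v _; exact: fro_ge0.
have q_ge0 := ltW q_gt0.
rewrite -ensemble_scale ?invr_ge0 //.
rewrite -ler_pdivlMl // -cost_scale ?invr_ge0 //.
apply: convex_roof_le; rewrite ensemble_scale ?invr_ge0 // mxtraceZ.
by rewrite tr_ensemble -rmorphM mulVf.
Qed.

End Roof.

(** * Attainment of vanishing convex roofs *)

(** Induction on the size of the support: while it exceeds [d], a linear relation between the rows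
    of [X] in the support allows one coefficient to be moved to 0. *)
Lemma conic_caratheodory (K : realFieldType) m d (X : 'M[K]_(m, d))
    (p : 'rV[K]_m) : (forall i, 0 <= p 0 i) ->
  exists q : 'rV[K]_m, [/\ forall i, 0 <= q 0 i, q *m X = p *m X
    & (#|[set i | (q 0 i != 0)%R]| <= d)%N].
Proof.
have [k] := ubnP #|[set i | p 0 i != 0]|; elim: k p => // k IH p.
rewrite ltnS => lek p0; set S := [set i | p 0 i != 0] in lek *.
have [led|ltd] := leqP #|S| d; first by exists p.
pose f (j : 'I_#|S|) : 'I_m := enum_val j.
have [c [cX c0 cS]] : exists c : 'rV[K]_m,
    [/\ c *m X = 0, c != 0 & forall i, c 0 i != 0 -> i \in S].
  have : kermx (rowsub f X) != 0.
    rewrite kermx_eq0 /row_free neq_ltn (leq_ltn_trans _ ltd) //.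
    exact: rank_leq_col.
  case/rowV0Pn => c' /sub_kermxP c'X c'0.
  have cE i : (c' *m rowsub f 1%:M) 0 i = \sum_j c' 0 j * (f j == i)%:R.
    by rewrite mxE; apply: eq_bigr => j _; rewrite !mxE.
  exists (c' *m rowsub f 1%:M); split.
  - by rewrite -mulmxA mul_rowsub_mx mul1mx.
  - apply: contraNneq c'0 => h; apply/eqP/rowP => j; rewrite [RHS]mxE.
    have /rowP/(_ (f j)) := h; rewrite cE mxE => <-.
    rewrite (bigD1 j) //= eqxx mulr1 big1 ?addr0 // => j' jj'.
    by rewrite (inj_eq enum_val_inj) (negbTE jj') mulr0.
  move=> i; apply: contraNT => iS; apply/eqP; rewrite cE big1 // => j _.
  case: eqP => [e|_]; last by rewrite mulr0.
  by rewrite -e enum_valP in iS.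
(* Up to sign the relation has a positive coefficient, without which no coordinate of [p - t *: c]
   would decrease for positive t. *)
have {c cX c0 cS} [c [cX cS [i1 ci1]]] : exists c : 'rV[K]_m,
    [/\ c *m X = 0, forall i, c 0 i != 0 -> i \in S & exists i, 0 < c 0 i].
  have [/existsP[i ci]|/existsPn cneg] := boolP [exists i, 0 < c 0 i].
    by exists c; split=> //; exists i.
  exists (- c); split; first by rewrite mulNmx cX oppr0.
    by move=> i; rewrite mxE oppr_eq0; exact: cS.
  have /existsP[i ci] : [exists i, c 0 i != 0].
    apply: contraNT c0 => /existsPn h; apply/eqP/rowP => i; rewrite [RHS]mxE.
    by apply/eqP; have := h i; rewrite negbK.
  exists i; rewrite mxE oppr_gt0 lt_def eq_sym ci leNgt.
  exact: cneg.
(* The least ratio is the largest step keeping all coordinates nonnegative, and it annihilates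
   coordinate [i0]. As [c] is supported in [S], the support strictly shrinks. *)
pose i0 := [arg min_(i < i1 | 0 < c 0 i) (p 0 i / c 0 i)]%O.
have [ci0 min0] : 0 < c 0 i0 /\
    forall i, 0 < c 0 i -> p 0 i0 / c 0 i0 <= p 0 i / c 0 i.
  by rewrite /i0; case: arg_minP => // i ci mi; split.
pose t := p 0 i0 / c 0 i0.
have t0 : 0 <= t by rewrite divr_ge0 // ltW.
pose q := p - t *: c.
have qX : q *m X = p *m X by rewrite mulmxBl -scalemxAl cX scaler0 subr0.
have q0 i : 0 <= q 0 i.
  rewrite !mxE subr_ge0; have [ci|ci] := ltP 0 (c 0 i).
    by rewrite -ler_pdivlMr //; exact: min0.
  by apply: le_trans (p0 i); rewrite mulr_ge0_le0.
have [q' [q'0 q'X le']] : exists q' : 'rV[K]_m,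
    [/\ forall i, 0 <= q' 0 i, q' *m X = q *m X
      & (#|[set i | (q' 0 i != 0)%R]| <= d)%N].
  apply: IH => //; apply: leq_trans lek; apply: proper_card.
  apply/properP; split.
    apply/fintype.subsetP => i; rewrite !inE !mxE; apply: contraNneq => pi0.
    have ci : c 0 i = 0.
      apply/eqP; apply: contraT => /cS; rewrite inE pi0 eqxx //.
    by rewrite pi0 ci mulr0 subr0.
  exists i0; first by apply: cS; rewrite gt_eqF.
  by rewrite !inE !mxE /t divfK ?subrr ?eqxx // gt_eqF.
by exists q'; split=> //; rewrite q'X.
Qed.

Section Reduction.
Variable R : realType.
Local Notation C := R[i].
Variable n : nat.
Variable E : 'cV[C]_n -> R.
Hypothesis EZ : forall z psi, E (z *: psi) = sq z * E psi.

Let I := option ('I_n * 'I_n * bool).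

(* Conic Caratheodory in the real coordinates of the projectors, with one more
   coordinate recording [E] so that the cost does not change. *)
Lemma ensemble_reduce (s : seq 'cV[C]_n) : exists s',
  [/\ (size s' <= #|{: I}|)%N, ensemble s' = ensemble s &
      \sum_(v <- s') E v = \sum_(v <- s) E v].
Proof.
pose vec (i : 'I_(size s)) : 'cV[C]_n := nth 0 s i.
pose crd (v : 'cV[C]_n) (t : I) : R :=
  if t is Some (a, b, c) then
    if c then complex.Im (projector v a b) else complex.Re (projector v a b)
  else E v.
pose X : 'M[R]_(size s, #|{: I}|) := \matrix_(i, t) crd (vec i) (enum_val t).
have [|q [q0 qX le]] := @conic_caratheodory _ _ _ X (const_mx 1).
  by move=> i; rewrite mxE.
have {}qX t : \sum_i q 0 i * crd (vec i) t = \sum_i crd (vec i) t.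
  have /rowP/(_ (enum_rank t)) := qX; rewrite !mxE => h.
  have eX i : X i (enum_rank t) = crd (vec i) t by rewrite mxE enum_rankK.
  under eq_bigr do rewrite -eX.
  by rewrite h; apply: eq_bigr => i _; rewrite mxE eX mul1r.
pose s' := [seq (Num.sqrt (q 0 i))%:C *: vec i | i <- enum [set i | q 0 i != 0]].
have sqq i : sq (Num.sqrt (q 0 i))%:C = q 0 i.
  by rewrite -cabs2 cabs_real ?sqrtr_ge0 // sqr_sqrtr.
have sum_s (V : nmodType) (F : 'cV[C]_n -> V) :
    \sum_(v <- s) F v = \sum_i F (vec i).
  by rewrite (big_nth 0) big_mkord.
exists s'; split; first by rewrite size_map -cardE.
- rewrite /ensemble sum_s big_map big_enum_cond /=.
  transitivity (\sum_i (q 0 i)%:C *: projector (vec i)).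
    rewrite big_mkcond; apply: eq_bigr => i _; rewrite !inE andbT projectorZ sqq.
    by case: eqVneq => [->|//]; rewrite scale0r.
  apply/matrixP=> a b; rewrite !summxE.
  have ReD (F : 'I_(size s) -> C) :
    complex.Re (\sum_t F t) = \sum_t complex.Re (F t).
    by elim/big_rec2: _ => // i y1 [x y] _ /= ->; case: (F i).
  have ImD (F : 'I_(size s) -> C) :
    complex.Im (\sum_t F t) = \sum_t complex.Im (F t).
    by elim/big_rec2: _ => // i y1 [x y] _ /= ->; case: (F i).
  apply/eqP; rewrite eq_complex !ReD !ImD.
  have -> : \sum_t complex.Re (((q 0 t)%:C *: projector (vec t)) a b) =
      \sum_t q 0 t * crd (vec t) (Some (a, b, false)).
    apply: eq_bigr => t _; rewrite [in LHS]mxE /crd.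
    by case: (projector _ a b) => x y /=; rewrite mul0r subr0.
  have -> : \sum_t complex.Im (((q 0 t)%:C *: projector (vec t)) a b) =
      \sum_t q 0 t * crd (vec t) (Some (a, b, true)).
    apply: eq_bigr => t _; rewrite [in LHS]mxE /crd.
    by case: (projector _ a b) => x y /=; rewrite mul0r addr0.
  by rewrite !qX !eqxx.
rewrite sum_s big_map big_enum_cond /= -(qX None).
rewrite big_mkcond; apply: eq_bigr => i _; rewrite !inE andbT EZ sqq /=.
by case: eqVneq => [->|//]; rewrite mul0r.
Qed.

End Reduction.

(** * Continuity of the tangles in the amplitudes *)

Section ComplexContinuity.
Variable R : realType.
Local Notation C := R[i].
Variable T : topologicalType.
Implicit Types f g : T -> C.

(** Stated on real and imaginary parts, so that only the topology of [R] enters. *)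
Definition ccont f : Prop :=
  continuous (fun x => complex.Re (f x)) /\ continuous (fun x => complex.Im (f x)).

Lemma ccontD f g : ccont f -> ccont g -> ccont (fun x => f x + g x).
Proof.
move=> [f1 f2] [g1 g2]; split=> x.
  rewrite (_ : (fun _ => _) = (fun x => complex.Re (f x) + complex.Re (g x))).
    by apply: cvgD; [exact: f1|exact: g1].
  by apply/funext => y; case: (f y); case: (g y).
rewrite (_ : (fun _ => _) = (fun x => complex.Im (f x) + complex.Im (g x))).
  by apply: cvgD; [exact: f2|exact: g2].
by apply/funext => y; case: (f y); case: (g y).
Qed.

Lemma ccontM f g : ccont f -> ccont g -> ccont (fun x => f x * g x).
Proof.
move=> [f1 f2] [g1 g2]; split=> x.
  rewrite (_ : (fun _ => _) = (fun x => complex.Re (f x) * complex.Re (g x) -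
      complex.Im (f x) * complex.Im (g x))).
    by apply: cvgB; apply: cvgM; [exact: f1|exact: g1|exact: f2|exact: g2].
  by apply/funext => y; case: (f y); case: (g y).
rewrite (_ : (fun _ => _) = (fun x => complex.Re (f x) * complex.Im (g x) +
    complex.Im (f x) * complex.Re (g x))).
  by apply: cvgD; apply: cvgM; [exact: f1|exact: g2|exact: f2|exact: g1].
by apply/funext => y; case: (f y) => a b; case: (g y).
Qed.

Lemma ccont_cst z : ccont (fun=> z).
Proof. by split=> x; exact: cvg_cst. Qed.

Lemma ccontN f : ccont f -> ccont (fun x => - f x).
Proof.
move=> cf; rewrite (_ : (fun _ => _) = (fun x => (-1) * f x)).
  by apply: ccontM => //; exact: ccont_cst.
by apply/funext => x; rewrite mulN1r.
Qed.

Lemma ccont_conj f : ccont f -> ccont (fun x => Num.conj (f x)).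
Proof.
move=> [f1 f2]; split=> x.
  rewrite (_ : (fun _ => _) = (fun x => complex.Re (f x))); first exact: f1.
  by apply/funext => y; case: (f y).
rewrite (_ : (fun _ => _) = (fun x => - complex.Im (f x))).
  by apply: cvgN; exact: f2.
by apply/funext => y; case: (f y).
Qed.

Lemma continuous_sum_real (J : Type) (r : seq J) (F : J -> T -> R) :
  (forall i, continuous (F i)) -> continuous (fun x => \sum_(i <- r) F i x).
Proof.
move=> cF; elim: r => [|i r IH] x.
  rewrite (_ : (fun _ => _) = (fun=> 0)); first exact: cvg_cst.
  by apply/funext => y; rewrite big_nil.
rewrite (_ : (fun _ => _) = (fun y => F i y + \sum_(j <- r) F j y)).
  by apply: cvgD; [exact: cF|exact: IH].
by apply/funext => y; rewrite big_cons.
Qed.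

Lemma ccont_sum (J : Type) (r : seq J) (F : J -> T -> C) :
  (forall i, ccont (F i)) -> ccont (fun x => \sum_(i <- r) F i x).
Proof.
move=> cF; elim: r => [|i r IH].
  rewrite (_ : (fun _ => _) = (fun=> 0)); first exact: ccont_cst.
  by apply/funext => y; rewrite big_nil.
rewrite (_ : (fun _ => _) = (fun y => F i y + \sum_(j <- r) F j y)).
  by apply: ccontD.
by apply/funext => y; rewrite big_cons.
Qed.

Lemma continuous_sq f : ccont f -> continuous (fun x => sq (f x)).
Proof.
move=> [f1 f2] x.
rewrite (_ : (fun _ => _) = (fun x => complex.Re (f x) * complex.Re (f x) +
    complex.Im (f x) * complex.Im (f x))).
  by apply: cvgD; apply: cvgM; do ?[exact: f1|exact: f2].
by apply/funext => y; rewrite sq.unlock !expr2.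
Qed.

Lemma continuous_sqrt (h : T -> R) :
  continuous h -> continuous (fun x => Num.sqrt (h x)).
Proof.
by move=> ch x; apply: continuous_comp; [exact: ch|exact: sqrt_continuous].
Qed.

Lemma continuous_cabs f : ccont f -> continuous (fun x => cabs (f x)).
Proof.
move=> cf; rewrite (_ : (fun _ => _) = (fun x => Num.sqrt (sq (f x)))).
  by apply: continuous_sqrt; exact: continuous_sq.
by apply/funext => x; rewrite cabs.unlock.
Qed.

Lemma continuous_fro m n (A : T -> 'M[C]_(m, n)) :
  (forall i j, ccont (fun x => A x i j)) -> continuous (fun x => fro (A x)).
Proof.
move=> cA; apply: continuous_sum_real => i; apply: continuous_sum_real => j.
exact: continuous_sq.
Qed.

Lemma continuous_nuc (Q : T -> 'M[C]_2) :
  (forall i j, ccont (fun x => Q x i j)) -> continuous (fun x => nuc (Q x)).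
Proof.
move=> cQ; apply: continuous_sqrt => x; apply: cvgD; first exact: continuous_fro.
apply: cvgM; first exact: cvg_cst.
apply: continuous_cabs x.
rewrite (_ : (fun _ => _) = (fun x => Q x 0 0 * Q x 1 1 + - (Q x 0 1 * Q x 1 0))).
  by apply: ccontD; last apply: ccontN; apply: ccontM.
by apply/funext => x; rewrite det2.
Qed.

Lemma continuous_tangle i j (psi : T -> 'cV[C]_(2 * 2 * 2)) :
  (forall a, ccont (fun x => psi x a ord0)) ->
  continuous (fun x => tangle i j (psi x)).
Proof.
move=> cpsi x; rewrite tangle.unlock; apply: cvgM; first exact: cvg_cst.
apply: continuous_nuc x => s t.
have cs u a b : ccont (fun x => slice i j (psi x) u a b).
  rewrite (_ : (fun _ => _) =
    (fun x => psi x (split_index i j (mxtens_index (a, b)) u) ord0)) //.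
  by apply/funext => x; rewrite mxE.
rewrite (_ : (fun _ => _) =
    (fun x => pdet (slice i j (psi x) s) (slice i j (psi x) t))).
  apply: ccontM; last exact: ccont_cst.
  do 2?[apply: ccontD; last by apply: ccontN; exact: ccontM].
  by apply: ccontD; exact: ccontM.
by apply/funext => x; rewrite mxE.
Qed.

Lemma continuous_tangle_prod (psi : T -> 'cV[C]_(2 * 2 * 2)) :
  (forall a, ccont (fun x => psi x a ord0)) ->
  continuous (fun x => tangle_prod (psi x)).
Proof.
move=> cpsi x; apply: cvgM; last exact: continuous_tangle.
by apply: cvgM; exact: continuous_tangle.
Qed.

Lemma continuous_tangle_min (psi : T -> 'cV[C]_(2 * 2 * 2)) :
  (forall a, ccont (fun x => psi x a ord0)) ->
  continuous (fun x => tangle_min (psi x)).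
Proof.
move=> cpsi x.
apply: (@continuous_min _ _ (fun x => tangle partyA partyB (psi x))
  (fun x => Num.min (tangle partyB partyC (psi x)) (tangle partyC partyA (psi x)))).
  exact: continuous_tangle.
by apply: (@continuous_min _ _ (fun x => tangle partyB partyC (psi x))
  (fun x => tangle partyC partyA (psi x))); exact: continuous_tangle.
Qed.

End ComplexContinuity.

Section Compactness.
Variable R : realType.
Local Notation C := R[i].

(** Continuity along all parametrisations by real row vectors, the form in which compactness is
    used. *)
Definition vcontinuous n (G : 'cV[C]_n -> R) : Prop :=
  forall k (psi : 'rV[R]_k -> 'cV[C]_n),
    (forall a, ccont (fun x => psi x a ord0)) -> continuous (fun x => G (psi x)).

(** In real coordinates, the [N]-tuples that decompose [rho] form the zero set of the continuous
    function [h]. It is bounded because the squared norms of the vectors add up to \tr rho = 1. *)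
Lemma ensemble_min (N n : nat) (rho : 'M[C]_n) (G : 'cV[C]_n -> R) :
  \tr rho = 1 -> vcontinuous G ->
  (exists w : 'I_N -> 'cV[C]_n, rho = \sum_l projector (w l)) ->
  exists2 w : 'I_N -> 'cV[C]_n, rho = \sum_l projector (w l) &
    forall w' : 'I_N -> 'cV[C]_n, rho = \sum_l projector (w' l) ->
      \sum_l G (w l) <= \sum_l G (w' l).
Proof.
move=> tr1 cG [w0 rho_w0].
pose J := ('I_N * 'I_n * bool)%type.
pose W (x : 'rV[R]_#|{: J}|) (l : 'I_N) : 'cV[C]_n :=
  \col_a (x 0 (enum_rank (l, a, false)) +i* x 0 (enum_rank (l, a, true))).
have WK (w : 'I_N -> 'cV[C]_n) : exists x, forall l, W x l = w l.
  exists (\row_t let: (l, a, c) := enum_val t in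
    if c then complex.Im (w l a 0) else complex.Re (w l a 0)) => l.
  apply/colP => a; rewrite !mxE !enum_rankK.
  by case: (w l a 0).
have cW l a : ccont (fun x => W x l a ord0).
  split=> x.
    rewrite (_ : (fun _ => _) = (fun x : 'rV[R]_#|{: J}| =>
      x 0 (enum_rank (l, a, false)))); first exact: coord_continuous.
    by apply/funext => y; rewrite mxE.
  rewrite (_ : (fun _ => _) = (fun x : 'rV[R]_#|{: J}| =>
    x 0 (enum_rank (l, a, true)))); first exact: coord_continuous.
  by apply/funext => y; rewrite mxE.
pose h x := fro (\sum_l projector (W x l) - rho).
have ch : continuous h.
  apply: continuous_fro => a b.
  rewrite (_ : (fun _ => _) = (fun x =>
      (\sum_l W x l a ord0 * Num.conj (W x l b ord0)) + - rho a b)).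
    apply: ccontD; last exact: ccont_cst.
    by apply: ccont_sum => l; apply: ccontM => //; exact: ccont_conj.
  apply/funext => x; rewrite !mxE summxE; congr (_ - _).
  by apply: eq_bigr => l _; rewrite projectorE.
pose A : set 'rV[R]_#|{: J}| := (h @^-1` [set 0])%classic.
have AP x : A x <-> rho = \sum_l projector (W x l).
  split=> [/fro_eq0/eqP|e]; first by rewrite subr_eq0 => /eqP.
  by rewrite /A /= /h -e subrr /fro big1 // => i _; rewrite big1 // => j _;
    rewrite mxE sq0.
have closedA : closed A.
  by apply: (preimage_closed _ (@closed_eq R 0)) => y _; exact: ch.
pose B : set 'rV[R]_#|{: J}| :=
  [set x : 'rV[R]_#|{: J}| | forall i, `[(-1 : R), 1]%classic (x ord0 i)]%classic.
have compactB : compact B.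
  apply: (@rV_compact R #|{: J}| (fun=> `[(-1 : R), 1]%classic)) => i.
  exact: segment_compact.
have AB : (A `<=` B)%classic.
  move=> x /AP e t.
  have sq1 l a : sq (W x l a 0) <= 1.
    have : \tr rho = (\sum_l fro (W x l))%:C.
      rewrite e raddf_sum rmorph_sum; apply: eq_bigr => l' _.
      exact: tr_projector.
    rewrite tr1 => /(@complexI R) ->.
    rewrite (bigD1 l) //= {1}/fro (bigD1 a) //= big_ord1 -addrA lerDl.
    rewrite addr_ge0 //; apply: sumr_ge0 => *; last exact: fro_ge0.
    by apply: sumr_ge0 => *; exact: sq_ge0.
  have bd (y z : R) : y ^+ 2 + z ^+ 2 <= 1 -> -1 <= y <= 1.
    by move=> yz; have := sqr_ge0 z; nra.
  rewrite /= in_itv /= -[t]enum_valK.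
  case: (enum_val t) => -[l a] c; have := sq1 l a; rewrite sq.unlock mxE /=.
  by case: c; [rewrite addrC|]; exact: bd.
have compactA : compact A by exact: subclosed_compact closedA compactB AB.
have A0 : (A !=set0)%classic.
  have [x xw] := WK w0; exists x; apply/AP; rewrite rho_w0.
  by apply: eq_bigr => l _; rewrite xw.
have cf : continuous (fun x => \sum_l G (W x l)).
  apply: continuous_sum_real => l; apply: cG => a; exact: cW.
have [x xA xmin] := EVT_min_rV A0 compactA (continuous_subspaceT cf).
exists (W x); first by apply/AP; rewrite inE in xA.
move=> w' rho_w'; have [x' x'w] := WK w'.
have -> : \sum_l G (w' l) = \sum_l G (W x' l).
  by apply: eq_bigr => l _; rewrite x'w.
apply: xmin; rewrite inE; apply/AP; rewrite rho_w'.
by apply: eq_bigr => l _; rewrite x'w.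
Qed.

End Compactness.

Section Detection.
Variable R : realType.
Local Notation C := R[i].
Variables Ep E G : 'cV[C]_(2 * 2 * 2) -> R.
Hypothesis EpE : forall psi, unit_vector psi -> Ep psi = E psi.
Hypothesis E_ge0 : forall psi, 0 <= E psi.
Hypothesis EZ : forall z psi, E (z *: psi) = sq z * E psi.
Hypothesis E_eq0 : forall psi, E psi = 0 <-> biseparable_pure psi.
(* [G] stands in for [E] in the compactness argument, where continuity is
   needed: for the geometric mean it avoids the cube root. *)
Hypothesis G_ge0 : forall psi, 0 <= G psi.
Hypothesis G_eq0 : forall psi, G psi = 0 <-> biseparable_pure psi.
Hypothesis G_le : forall psi, E psi <= 1 -> G psi <= E psi.
Hypothesis G_cont : vcontinuous G.

(** If the roof vanishes, ensembles of the fixed length [N] reach arbitrarily small totals of [E],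
    hence of [G]. The minimiser for [G] then has total 0, and all its vectors are biseparable. *)
Lemma convex_roof_detects : detects_gme (convex_roof Ep).
Proof.
move=> rho drho; split=> [pos [m [p [psi [dec bis]]]]|nbis].
  have := convex_roof_le_decomposition EpE E_ge0 dec.
  rewrite leNgt big1 ?pos // => l _.
  case: dec => _ _ u _; rewrite EpE //.
  by have /E_eq0-> := bis l; rewrite mulr0.
rewrite ltNge; apply/negP => roof0; apply: nbis.
have tr1 : \tr rho = 1 by case: drho.
set N := #|{: option ('I_(2 * 2 * 2) * 'I_(2 * 2 * 2) * bool)}|.
have small (e : R) : 0 < e -> exists2 w : 'I_N -> 'cV[C]_(2 * 2 * 2),
    rho = \sum_l projector (w l) & \sum_l E (w l) < e.
  move=> e0; have [s es lt] := convex_roof_near EpE E_ge0 EZ drho e0.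
  have [s' [le es' Es']] := ensemble_reduce EZ s.
  (* The default value of [nth] pads the list with zero vectors up to length [N]. *)
  have sum_s' (V : nmodType) (F : 'cV[C]_(2 * 2 * 2) -> V) : F 0 = 0 ->
      \sum_(v <- s') F v = \sum_(l < N) F (nth 0 s' l).
    move=> F0; rewrite (big_nth 0) big_mkord.
    rewrite (big_ord_widen N (fun l => F (nth 0 s' l)) le) big_mkcond /=.
    by apply: eq_bigr => l _; case: ltnP => // /(nth_default 0)->.
  exists (fun l => nth 0 s' l).
    by rewrite es -es' /ensemble sum_s' // /projector mul0mx.
  rewrite -(sum_s' _ E); last by rewrite -(scale0r 0) EZ sq0 mul0r.
  by rewrite Es'; apply: lt_le_trans lt _; rewrite gerDr.
have [w0 rho_w0 _] := small 1 ltr01.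
have [w rho_w wmin] := ensemble_min tr1 G_cont (ex_intro _ w0 rho_w0).
have Gw l : G (w l) = 0.
  have le0 : \sum_l G (w l) <= 0.
    apply/ler_addgt0Pr => e e0; rewrite add0r.
    (* The bound 1 keeps every single [E (w' k)] in the range where [G_le] applies. *)
    have e1 : 0 < Num.min e 1 by rewrite lt_min e0 ltr01.
    have [w' rho_w' lt] := small _ e1; apply: le_trans (wmin w' rho_w') _.
    have {}lt : \sum_l E (w' l) < e /\ \sum_l E (w' l) < 1.
      by apply/andP; rewrite -lt_min.
    apply: le_trans (ltW lt.1); apply: ler_sum => k _; apply: G_le.
    apply: le_trans (ltW lt.2); rewrite (bigD1 k) //= lerDl.
    exact: sumr_ge0.
  apply/eqP; rewrite eq_le G_ge0 andbT; apply: le_trans le0.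
  by rewrite (bigD1 l) //= lerDl; exact: sumr_ge0.
pose s := [seq w l | l <- enum 'I_N].
have es : rho = ensemble s by rewrite /ensemble big_map big_enum.
rewrite es in tr1 *.
have [m [p [psi [dec _ psi_s]]]] := ensemble_decomposition EZ tr1.
exists m, p, psi; split=> // l; have [z [v [/mapP[k _ ->] ->]]] := psi_s l.
by apply/E_eq0; rewrite EZ; have /G_eq0/E_eq0-> := Gw k; rewrite mulr0.
Qed.

End Detection.

Theorem theorem4 (R : realType) :
  gme_measure (@Tmin R) /\ gme_measure (@TGM R).
Proof.
split; split.
- apply: (@convex_roof_detects _ _ (@tangle_min R) (@tangle_min R)).
  + exact: Tmin_pureE.
  + exact: tangle_min_ge0.
  + exact: tangle_minZ.
  + exact: tangle_min_eq0.
  + exact: tangle_min_ge0.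
  + exact: tangle_min_eq0.
  + by [].
  + by move=> k psi cpsi; exact: continuous_tangle_min.
- exact: (convex_roof_local_unitary (@Tmin_pureE R) (@tangle_min_ge0 R)
    (@tangle_minZ R) (@tangle_min_kraus R)).
- exact: (convex_roof_locc (@Tmin_pureE R) (@tangle_min_ge0 R)
    (@tangle_minZ R) (@tangle_min_kraus R)).
- exact: (convex_roof_convex (@Tmin_pureE R) (@tangle_min_ge0 R)
    (@tangle_minZ R)).
- apply: (@convex_roof_detects _ _ (@tangle_gm R) (@tangle_prod R)).
  + exact: TGM_pureE.
  + exact: tangle_gm_ge0.
  + exact: tangle_gmZ.
  + exact: tangle_gm_eq0.
  + exact: tangle_prod_ge0.
  + exact: tangle_prod_eq0.
  + exact: tangle_prod_le_gm.
  + by move=> k psi cpsi; exact: continuous_tangle_prod.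
- exact: (convex_roof_local_unitary (@TGM_pureE R) (@tangle_gm_ge0 R)
    (@tangle_gmZ R) (@tangle_gm_kraus R)).
- exact: (convex_roof_locc (@TGM_pureE R) (@tangle_gm_ge0 R)
    (@tangle_gmZ R) (@tangle_gm_kraus R)).
- exact: (convex_roof_convex (@TGM_pureE R) (@tangle_gm_ge0 R)
    (@tangle_gmZ R)).
Qed.
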